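(* Let $K\subset\mathbb{R}^2$ be a symmetric convex domain. For each $\theta\in\mathbb{R}$ let $A(\theta)$ be the maximal area of a triangle $\mathbf{x}\mathbf{y}\mathbf{z}$ inscribed in $K$ such that $\mathbf{x}\in L(\theta)$ and the side $\mathbf{y}\mathbf{z}$ is parallel to $L(\theta)$, where $L(\theta)$ is the support line of $K$ in direction $\mathbf{u}_\theta=(\cos\theta,\sin\theta)$. Then $K$ is inextensible (with respect to lattice covering) if and only if the function $A(\theta)$ is constant.
   Context: A symmetric convex domain (or just ''domain'') is a convex compact set $K\subset\mathbb{R}^2$ with nonempty interior such that $K=-K$. A lattice is a set $\Lambda=B\mathbb{Z}^2$ with $B$ a nonsingular linear map of $\mathbb{R}^2$; its determinant is $d(\Lambda)=|\det B|$ (independent of the choice of $B$). The lattice $\Lambda$ is $K$-covering if $K+\Lambda=\mathbb{R}^2$. The critical determinant $\Delta(K)$ is the maximum of $d(\Lambda)$ over all $K$-covering lattices $\Lambda$ (the maximum is attained). $K$ is extensible if there is a symmetric convex domain $K'\supseteq K$ with $K'\neq K$ and $\Delta(K')=\Delta(K)$. Otherwise $K$ is inextensible. The support height is $h(\theta)=\max_{\mathbf{x}\in K}\langle\mathbf{x},\mathbf{u}_\theta\rangle$ and the support line is $L(\theta)=\{\mathbf{x}\in\mathbb{R}^2:\langle\mathbf{x},\mathbf{u}_\theta\rangle=h(\theta)\}$. A triangle is inscribed in $K$ if its vertices lie on the boundary of $K$. *)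

(* Defs.v *)
(* MathComp-Analysis; the plane is the type 'rV[R]_2 of row vectors. *)
From HB Require Import structures.
From mathcomp Require Import all_boot all_order all_algebra.
From mathcomp Require Import all_classical all_reals all_analysis.
Set Implicit Arguments.
Unset Strict Implicit.
Unset Printing Implicit Defensive.
Import Order.TTheory GRing.Theory Num.Theory.
Import numFieldNormedType.Exports.
Local Open Scope classical_set_scope.
Local Open Scope ring_scope.

Section Plane.
Context {R : realType}.
Implicit Types (K L : set 'rV[R]_2) (B : 'M[R]_2) (x y z u v : 'rV[R]_2).
Implicit Type theta : R.

Definition symmetric_convex_domain K : Prop :=
  [/\ convex_set K, compact K, K° !=set0 & K = -%R @` K].

(* Row-vector convention: the linear map of the plane is v |-> v *m B. *)
Definition lattice B : set 'rV[R]_2 :=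
  [set map_mx intr n *m B | n in [set: 'rV[int]_2]].

Definition covering K L : Prop := [set x + v | x in K & v in L] = setT.

(* The maximum is attained for a symmetric convex domain, so that it is the
   supremum. *)
Definition critical_determinant K : R :=
  sup [set `|\det B| | B in [set B | B \in unitmx /\ covering K (lattice B)]].

Definition extensible K : Prop :=
  exists K' : set 'rV[R]_2,
    [/\ symmetric_convex_domain K', K `<=` K', K' <> K &
        critical_determinant K' = critical_determinant K].

Definition inextensible K : Prop := ~ extensible K.

Definition dotp u v : R := (u *m v^T) 0 0.

Definition dir theta : 'rV[R]_2 :=
  \row_(i < 2) if i == 0 then cos theta else sin theta.

(* The maximum over K is attained since K is compact and nonempty. *)
Definition support_height K theta : R := sup [set dotp x (dir theta) | x in K].

Definition support_line K theta : set 'rV[R]_2 :=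
  [set x | dotp x (dir theta) = support_height K theta].

Definition boundary K : set 'rV[R]_2 := closure K `\` K°.

Definition triangle_area x y z : R := `|\det (col_mx (y - x) (z - x))| / 2.

(* Triangles are nondegenerate. *)
Definition inscribed_triangle K x y z : Prop :=
  [/\ 0 < triangle_area x y z, boundary K x, boundary K y & boundary K z].

(* The maximum is attained for a symmetric convex domain. The side y z is
   parallel to the support line iff z - y is orthogonal to dir theta. *)
Definition max_triangle_area K theta : R :=
  sup [set a | exists x y z,
    [/\ inscribed_triangle K x y z, support_line K theta x,
        dotp (z - y) (dir theta) = 0 & a = triangle_area x y z]].

End Plane.

(* Main.v *)
Require Import Defs.
From mathcomp Require Import all_boot all_order all_algebra.
From mathcomp Require Import all_classical all_reals all_analysis.
From mathcomp Require Import ring lra.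
Set Implicit Arguments.
Unset Strict Implicit.
Unset Printing Implicit Defensive.
Import Order.TTheory GRing.Theory Num.Theory numFieldNormedType.Exports.
Local Open Scope classical_set_scope.
Local Open Scope ring_scope.

(** Let M be twice the area of a largest triangle with vertices in K.

    The critical determinant of K is M ([critical_determinantE]). On the one
    hand, the differences of the vertices of a largest triangle generate a
    K-covering lattice of determinant M ([largest_triangle_covering]): a largest
    triangle contains the centre of K, and together with its reflection it tiles
    the plane after cutting and translating. On the other hand, a covering
    lattice has determinant at most M ([covering_det_le]): assigning to each
    point of a fine periodic grid a lattice point that covers it is a discrete
    map of degree one of a torus, so some small grid triangle is sent to a
    nondegenerate lattice triangle, and a translate of K almost contains it.

    The maximum of A is M / 2, because a largest triangle has its apex on the
    support line parallel to the opposite side. So if A is constant, it is M / 2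
    everywhere, and a point p of a larger domain K', which is strictly beyond
    some support line, is the apex of a triangle of more than the largest area;
    hence K' has a larger critical determinant
    ([max_triangle_area_inextensible]).

    Conversely let K be inextensible. Adjoining a point p near a boundary point x
    must create a triangle with vertex p and area more than M / 2, and in the
    limit x is the apex of a largest triangle ([inextensible_apex_limit]). Let x
    be on a support line. Approaching x from both sides along the line gives two
    largest triangles x y1 z1 and x y2 z2 with the directions of the bases on
    either side of that of the line, or parallel to it. If no base is parallel
    to the line, take two such triangles as close together as possible. There is
    a boundary point q between y1 and y2 for which the triangles x q z1 and
    x q z2 have the same area. It is a vertex of some largest triangle x' q z'.
    Two largest triangles whose vertices do not follow each other in the same
    order around the boundary can exchange vertices and remain largest
    ([exchange]); here this gives a largest triangle with apex x and vertex q,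
    and so either a connection between the two bases, along which the direction
    of the line occurs, or a pair of bases that is closer together, a
    contradiction ([optimal_opposite_bases_false]). *)

(** * Inequalities between real numbers *)

Section RealInequalities.
Context {R : realFieldType}.

(** The ratios a / A, b / B, c / C of two probability vectors have a least one,
    at most 1; the value 1 may therefore stand for a ratio with denominator 0. *)
Lemma min_ratio (A B C a b c : R) : 0 <= A -> 0 <= B -> 0 <= C ->
  A + B + C = 1 -> 0 <= a -> 0 <= b -> 0 <= c -> a + b + c = 1 ->
  exists m, [/\ 0 <= m, m * A <= a, m * B <= b, m * C <= c &
    [\/ m * A = a, m * B = b | m * C = c]].
Proof.
move=> A0 B0 C0 ABC a0 b0 c0 abc.
pose r (A a : R) := if A == 0 then 1 else a / A.
have rP (X u : R) : 0 <= X -> 0 <= u ->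
    [/\ 0 <= r X u, r X u * X <= u & (X != 0 -> r X u * X = u) /\ (X = 0 -> r X u = 1)].
  move=> X0 u0; rewrite /r; case: eqVneq => [->|X1]; split => //.
  - by rewrite mulr0.
  - by rewrite divr_ge0.
  - by rewrite divfK.
  - by split => [_|/eqP]; rewrite ?divfK ?(negPf X1).
have main (X Y Z u v w : R) : 0 <= X -> 0 <= Y -> 0 <= Z ->
  X + Y + Z = 1 -> 0 <= u -> 0 <= v -> 0 <= w -> u + v + w = 1 ->
  r X u <= r Y v -> r X u <= r Z w ->
  [/\ 0 <= r X u, r X u * X = u, r X u * Y <= v & r X u * Z <= w].
  move=> X0 Y0 Z0 XYZ u0 v0 w0 uvw uv uw.
  have [rX0 rX [rX1 rX2]] := rP _ _ X0 u0.
  have [rY0 rY _] := rP _ _ Y0 v0.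
  have [rZ0 rZ _] := rP _ _ Z0 w0.
  have hY : r X u * Y <= v by apply: le_trans rY; exact: ler_wpM2r.
  have hZ : r X u * Z <= w by apply: le_trans rZ; exact: ler_wpM2r.
  split => //; have [X00|] := eqVneq X 0; last exact: rX1.
  by move: hY hZ; rewrite rX2 // !mul1r; lra.
have BAC : B + A + C = 1 by lra.
have CAB : C + A + B = 1 by lra.
have bac : b + a + c = 1 by lra.
have cab : c + a + b = 1 by lra.
have [ab|/ltW ba] := leP (r A a) (r B b).
  have [ac|/ltW ca] := leP (r A a) (r C c).
    have [m0 ma mb mc] := main _ _ _ _ _ _ A0 B0 C0 ABC a0 b0 c0 abc ab ac.
    by exists (r A a); split => //; [rewrite ma|exact: Or31].
  have [m0 mc ma mb] := main _ _ _ _ _ _ C0 A0 B0 CAB c0 a0 b0 cab ca (le_trans ca ab).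
  by exists (r C c); split => //; [rewrite mc|exact: Or33].
have [bc|/ltW cb] := leP (r B b) (r C c).
  have [m0 mb ma mc] := main _ _ _ _ _ _ B0 A0 C0 BAC b0 a0 c0 bac ba bc.
  by exists (r B b); split => //; [rewrite mb|exact: Or32].
have [m0 mc ma mb] := main _ _ _ _ _ _ C0 A0 B0 CAB c0 a0 b0 cab (le_trans cb ba) cb.
by exists (r C c); split => //; [rewrite mc|exact: Or33].
Qed.

(** The only quantitative point is k + m ^ 2 / k >= 2 * m. The meaning of the
    variables is that of [optimal_opposite_bases_false], where the left-hand
    side is the supposed maximum. *)
Lemma crossing_gain (m e g k s t : R) : 0 <= e < m -> 0 <= g < m -> 0 < k <= m ->
  k * (s + t) = m -> s * m + t * g <= m -> e + g < k + (s * e + t * m).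
Proof.
move=> /andP[e0 em] /andP[g0 gm] /andP[k0 km] kst stg.
have st1 : 1 <= s + t by rewrite -(ler_pM2l k0) kst mulr1.
have h1 : (s + t - 1) * m <= t * (m - g) by lra.
have h2 : (s + t - 1) * (m - g) <= (s + t - 1) * m by rewrite ler_wpM2l //; lra.
have h3 : s + t - 1 <= t by rewrite -(@ler_pM2r _ (m - g)); lra.
have h4 : (s + t - 1) * (m - e) <= t * (m - e) by rewrite ler_wpM2r //; lra.
have h5 : 2 * m <= k + (s + t) * m.
  rewrite -(ler_pM2l k0).
  have := sqr_ge0 (k - m); rewrite sqrrB.
  have -> : k * (k + (s + t) * m) = k ^+ 2 + m * m by rewrite mulrDr mulrA kst; ring.
  by lra.
by lra.
Qed.

Lemma opposite_sign (a b c : R) : a * b < 0 -> 0 <= c * b -> c != 0 -> a * c < 0.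
Proof.
move=> ab cb c0; have b0 : b != 0 by apply: contraTneq ab => ->; rewrite mulr0 ltxx.
have b2 : 0 < b ^+ 2 by rewrite exprn_even_gt0.
rewrite -(pmulr_rlt0 _ b2) (_ : b ^+ 2 * (a * c) = (c * b) * (a * b)); last by ring.
by rewrite pmulr_rlt0 // lt_neqAle cb andbT eq_sym mulf_neq0.
Qed.

Lemma convex_zero (f g : R) : f * g <= 0 -> exists2 t, 0 <= t <= 1 & t * f + (1 - t) * g = 0.
Proof.
move=> fg; have [d|d] := eqVneq (f - g) 0.
  exists 0; first by rewrite lexx ler01.
  have fg' : f = g by apply/eqP; rewrite -subr_eq0 d.
  have : g ^+ 2 <= 0 by rewrite expr2 -{1}fg'.
  by rewrite real_exprn_even_le0 ?num_real //= => /eqP ->; ring.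
exists (- g / (f - g)); last by field.
have [d0|d0] := ltP 0 (f - g).
  rewrite divr_ge0 ?(ltW d0) //= ?ler_pdivrMr //; nra.
have {}d0 : f - g < 0 by rewrite lt_neqAle d.
rewrite -mulrNN -invrN opprK divr_ge0 /= ?ler_pdivrMr //; nra.
Qed.

End RealInequalities.

(** * Cross products and signed areas *)

Section Cross.
Context {R : realType}.
Implicit Types a b c x y z p q : 'rV[R]_2.

Definition cross a b : R := a 0 0 * b 0 1 - a 0 1 * b 0 0.

(** Twice the signed area: positive for counterclockwise triangles. *)
Definition area2 x y z : R := cross (y - x) (z - x).

Definition vec (s t : R) : 'rV[R]_2 := \row_(i < 2) if i == 0 then s else t.

Lemma vec0E s t : vec s t 0 0 = s. Proof. by rewrite mxE. Qed.
Lemma vec1E s t : vec s t 0 1 = t. Proof. by rewrite mxE. Qed.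

Lemma vecP a b : a 0 0 = b 0 0 -> a 0 1 = b 0 1 -> a = b.
Proof.
move=> e0 e1; apply/rowP => i; case: i => -[|[|//]] h.
- by rewrite (_ : Ordinal h = 0) //; apply/val_inj.
- by rewrite (_ : Ordinal h = 1) //; apply/val_inj.
Qed.

End Cross.

Ltac cross_ring := rewrite /area2 /cross ?(mxE, vec0E, vec1E) /=; ring.
Ltac vec_ring := apply: vecP; rewrite ?(mxE, vec0E, vec1E) /=; ring.

Section CrossTheory.
Context {R : realType}.
Implicit Types a b c d x y z p q u v : 'rV[R]_2.

Lemma crossC a b : cross a b = - cross b a.
Proof. cross_ring. Qed.
Lemma crossvv a : cross a a = 0.
Proof. cross_ring. Qed.
Lemma crossDl a b c : cross (a + b) c = cross a c + cross b c.
Proof. cross_ring. Qed.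
Lemma crossDr a b c : cross a (b + c) = cross a b + cross a c.
Proof. cross_ring. Qed.
Lemma crossNl a b : cross (- a) b = - cross a b.
Proof. cross_ring. Qed.
Lemma crossNr a b : cross a (- b) = - cross a b.
Proof. cross_ring. Qed.
Lemma crossBl a b c : cross (a - b) c = cross a c - cross b c.
Proof. cross_ring. Qed.
Lemma crossBr a b c : cross a (b - c) = cross a b - cross a c.
Proof. cross_ring. Qed.
Lemma crossZl s a b : cross (s *: a) b = s * cross a b.
Proof. cross_ring. Qed.
Lemma crossZr s a b : cross a (s *: b) = s * cross a b.
Proof. cross_ring. Qed.

(** The Grassmann-Pluecker relation: it determines the sign of one of six cross
    products from the others, which is how cyclic orders are compared below. *)
Lemma cross_pluecker a b c d :
  cross a b * cross c d + cross a d * cross b c = cross a c * cross b d.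
Proof. cross_ring. Qed.

Lemma cross_combination a b c :
  cross b c *: a + cross a b *: c = cross a c *: b.
Proof. by apply: vecP; rewrite !mxE /cross; ring. Qed.

Lemma area2E x y z : area2 x y z = cross x y + cross y z + cross z x.
Proof. cross_ring. Qed.
Lemma area2_rot x y z : area2 y z x = area2 x y z.
Proof. cross_ring. Qed.
Lemma area2_swap x y z : area2 x z y = - area2 x y z.
Proof. cross_ring. Qed.
Lemma area2N x y z : area2 (- x) (- y) (- z) = area2 x y z.
Proof. cross_ring. Qed.
Lemma area2_apex x x' y z :
  area2 x y z - area2 x' y z = cross (x - x') (y - z).
Proof. cross_ring. Qed.
Lemma area2_convex s a b y z :
  area2 (s *: a + (1 - s) *: b) y z = s * area2 a y z + (1 - s) * area2 b y z.
Proof. cross_ring. Qed.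

End CrossTheory.

(** * Symmetric convex domains *)

Section Domain.
Context {R : realType}.
Implicit Types (K : set 'rV[R]_2) (a b c x y z p q : 'rV[R]_2).

Lemma domain_opp K x : symmetric_convex_domain K -> K x -> K (- x).
Proof. by move=> [_ _ _ sK] Kx; rewrite sK; exists x. Qed.

Lemma domain_segment K s x y : symmetric_convex_domain K -> 0 <= s <= 1 ->
  K x -> K y -> K (s *: x + (1 - s) *: y).
Proof.
move=> [cK _ _ _] /andP[s0 s1] Kx Ky.
have := cK x y (Itv01 s0 s1); rewrite !inE => /(_ Kx Ky).
by [].
Qed.

Lemma domain0 K : symmetric_convex_domain K -> K 0.
Proof.
move=> hK; have [_ _ [c /interior_subset Kc] _] := hK.
have := domain_segment (s := 2^-1) hK _ Kc (domain_opp hK Kc).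
rewrite (_ : _ + _ = 0); first by apply; lra.
by apply: vecP; rewrite !mxE; field.
Qed.

Lemma domain_combination K s t x y : symmetric_convex_domain K ->
  0 <= s -> 0 <= t -> s + t <= 1 -> K x -> K y -> K (s *: x + t *: y).
Proof.
move=> hK s0 t0 st1 Kx Ky.
have [st|st] := eqVneq (s + t) 0.
  have -> : s = 0 by lra.
  have -> : t = 0 by lra.
  by rewrite !scale0r addr0; exact: domain0.
have st0 : 0 < s + t by rewrite lt_neqAle eq_sym st addr_ge0.
have Kz := domain_segment (s := s / (s + t)) hK _ Kx Ky.
have := domain_segment (s := s + t) hK _ (Kz _) (domain0 hK).
rewrite (_ : _ + _ = s *: x + t *: y); first apply.
- by apply/andP; split => //; lra.
- by rewrite divr_ge0 //= ?ler_pdivrMr; lra.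
- apply: vecP; rewrite !mxE; field => //; exact: st.
Qed.

Lemma domain_nbhs0 K : symmetric_convex_domain K ->
  exists2 r : R, 0 < r & forall x, `|x| < r -> K x.
Proof.
move=> hK; have [_ _ [c Kc] _] := hK.
have [r /= r0 rK] := (nbhs_ballP _ _).1 Kc.
exists (r / 2); first by rewrite divr_gt0.
move=> x xr.
have Kcx : K (c + 2 *: x).
  apply: rK; rewrite -ball_normE /= opprD addrA subrr sub0r normrN normrZ.
  by rewrite ger0_norm // mulrC -ltr_pdivlMr.
have Kc' : K c := interior_subset Kc.
have := domain_combination (s := 2^-1) (t := 2^-1) hK _ _ _ Kcx (domain_opp hK Kc').
rewrite (_ : _ *: _ + _ = x); first by apply; lra.
by apply: vecP; rewrite !mxE; field.
Qed.

Lemma domain_closed K : symmetric_convex_domain K -> closed K.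
Proof. by move=> [_ cK _ _]; apply: compact_closed => //; exact: norm_hausdorff. Qed.

Lemma domain_bounded K : symmetric_convex_domain K ->
  exists2 C : R, 0 < C & forall x, K x -> forall i j, `|x i j| <= C.
Proof.
move=> [_ /compact_bounded [M [_ MK]] _ _].
exists (`|M| + 1) => [|x Kx i j]; first by rewrite ltr_wpDl.
have h : `|x| <= `|M| + 1.
  by apply: MK => //; rewrite (le_lt_trans (ler_norm M)) // ltrDl.
apply: le_trans h; rewrite [leRHS]/Num.norm /= mx_normrE.
exact: (le_bigmax _ (fun ij => `|x ij.1 ij.2|) (i, j)).
Qed.

End Domain.

Section Continuity.
Context {R : realType} {T : topologicalType}.
Implicit Types f g h : T -> 'rV[R]_2.

Lemma continuous_cross f g : continuous f -> continuous g ->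
  continuous (fun t => cross (f t) (g t)).
Proof.
move=> cf cg t.
have cc (k : T -> 'rV[R]_2) j : continuous k -> {for t, continuous (fun t => k t 0 j)}.
  move=> ck; apply: (@continuous_comp _ _ _ k (fun v : 'rV[R]_2 => v 0 j)).
    exact: ck.
  exact: coord_continuous.
apply: (@continuousB _ _ _ (fun t => f t 0 0 * g t 0 1) (fun t => f t 0 1 * g t 0 0));
  by apply: continuousM; apply: cc.
Qed.

Lemma continuous_area2 f g h : continuous f -> continuous g -> continuous h ->
  continuous (fun t => area2 (f t) (g t) (h t)).
Proof.
move=> cf cg ch; apply: continuous_cross => t.
- by apply: continuousB; [exact: cg|exact: cf].
- by apply: continuousB; [exact: ch|exact: cf].
Qed.

Lemma compact_max (A : set T) (f : T -> R) : A !=set0 -> compact A ->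
  continuous f -> exists2 t, A t & forall u, A u -> f u <= f t.
Proof.
move=> A0 cA cf; have [|t] := compact_EVT_max A0 cA (f := f).
  exact: continuous_subspaceT.
rewrite inE => At h; exists t => // u Au; by apply: h; rewrite inE.
Qed.

End Continuity.

(** * Largest triangles *)

Section LargestTriangle.
Context {R : realType}.
Implicit Types (K : set 'rV[R]_2) (a b c x y z p q : 'rV[R]_2).

(** Maximality is over all triangles with vertices in K, in either orientation:
    a largest triangle is counterclockwise. *)
Definition largest_triangle K x y z : Prop :=
  [/\ K x, K y, K z & forall a b c, K a -> K b -> K c ->
    area2 a b c <= area2 x y z].

Lemma largest_triangle_exists K : symmetric_convex_domain K ->
  exists x y z, largest_triangle K x y z.
Proof.
move=> hK; have K0 := domain0 hK; have [_ cK _ _] := hK.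
have [|||[[x y] z] [[Kx Ky] Kz] xyz] :=
    @compact_max R ('rV[R]_2 * 'rV[R]_2 * 'rV[R]_2)%type (K `*` K `*` K)
      (fun t => area2 t.1.1 t.1.2 t.2).
- by exists (0, 0, 0).
- by apply: compact_setX => //; apply: compact_setX.
- apply: continuous_area2 => t.
  + by apply: continuous_comp; [exact: cvg_fst|exact: cvg_fst].
  + by apply: continuous_comp; [exact: cvg_fst|exact: cvg_snd].
  + exact: cvg_snd.
- exists x, y, z; split => // a b c Ka Kb Kc.
  exact: (xyz (a, b, c)).
Qed.

Lemma largest_triangle_gt0 K x y z : symmetric_convex_domain K ->
  largest_triangle K x y z -> 0 < area2 x y z.
Proof.
move=> hK [_ _ _ xyz]; have [r r0 rK] := domain_nbhs0 hK.
have Kd s t : `|s| <= r / 2 -> `|t| <= r / 2 -> K (vec s t).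
  move=> sr tr; apply: rK; rewrite /Num.norm /= mx_normrE.
  apply/bigmax_ltP; split => // -[i j] _ /=.
  rewrite mxE; case: ifP => _; apply: (@le_lt_trans _ _ (r / 2)) => //; lra.
have r2 : `|r / 2| <= r / 2 by rewrite ger0_norm //; lra.
have r20 : `|0 : R| <= r / 2 by rewrite normr0; lra.
have := xyz 0 (vec (r / 2) 0) (vec 0 (r / 2)) (domain0 hK) (Kd _ _ r2 r20) (Kd _ _ r20 r2).
apply: lt_le_trans; rewrite (_ : area2 _ _ _ = (r / 2) ^+ 2); last by cross_ring.
by rewrite exprn_gt0 // divr_gt0.
Qed.

Lemma largest_triangle_uniq K x y z x' y' z' :
  largest_triangle K x y z -> largest_triangle K x' y' z' ->
  area2 x' y' z' = area2 x y z.
Proof.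
move=> [Kx Ky Kz h] [Kx' Ky' Kz' h'].
by apply: le_anti; rewrite h // h'.
Qed.

End LargestTriangle.

Section LargestTriangleTheory.
Context {R : realType}.
Variables (K : set 'rV[R]_2) (hK : symmetric_convex_domain K).
Implicit Types (a b c x y z p q : 'rV[R]_2).

Lemma largest_triangle_rot x y z :
  largest_triangle K x y z -> largest_triangle K y z x.
Proof. by move=> [Kx Ky Kz h]; split=> // a b c *; rewrite (area2_rot x); exact: h. Qed.

Lemma largest_triangle_norm x y z a b c : largest_triangle K x y z ->
  K a -> K b -> K c -> `|area2 a b c| <= area2 x y z.
Proof.
move=> [_ _ _ h] Ka Kb Kc; rewrite ler_norml lerNl -area2_swap.
by rewrite !h.
Qed.

(** If the origin were strictly on the other side of the line y z, then replacing
    x by - x would increase the distance to that line. *)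
Lemma largest_triangle_origin x y z :
  largest_triangle K x y z -> 0 <= cross y z.
Proof.
move=> h; have [Kx Ky Kz _] := h.
have := largest_triangle_norm h (domain_opp hK Kx) Kz Ky.
rewrite ler_norml => /andP[_].
rewrite (_ : area2 (- x) z y = area2 x y z - 2 * cross y z); last by cross_ring.
by lra.
Qed.

(** The origin has barycentric coordinates at most 1 / 2: compare with the
    triangle whose vertices are y, z and - y. *)
Lemma largest_triangle_half x y z :
  largest_triangle K x y z -> 2 * cross y z <= area2 x y z.
Proof.
move=> h; have [Kx Ky Kz hm] := h.
have := hm _ _ _ Ky Kz (domain_opp hK Ky).
by rewrite (_ : area2 y z (- y) = 2 * cross y z) //; cross_ring.
Qed.

End LargestTriangleTheory.

Section Plane.
Context {R : realType}.
Implicit Types (a b v x y z : 'rV[R]_2) (B : 'M[R]_2).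

Lemma col_mx_row0 a b (j : 'I_2) : (col_mx a b : 'M[R]_2) 0 j = a 0 j.
Proof.
rewrite (_ : 0 = lshift 1 (0 : 'I_1) :> 'I_(1 + 1)); last exact/val_inj.
by rewrite (col_mxEu a b).
Qed.

Lemma col_mx_row1 a b (j : 'I_2) : (col_mx a b : 'M[R]_2) 1 j = b 0 j.
Proof.
rewrite (_ : 1 = rshift 1 (0 : 'I_1) :> 'I_(1 + 1)); last exact/val_inj.
by rewrite (col_mxEd a b).
Qed.

Lemma det2 B : \det B = B 0 0 * B 1 1 - B 0 1 * B 1 0.
Proof.
rewrite (expand_det_row _ 0) !big_ord_recl big_ord0 addr0 /cofactor !det_mx11 !mxE /=.
have -> : lift 0 0 = 1 :> 'I_2 by exact/val_inj.
have -> : lift 1 0 = 0 :> 'I_2 by exact/val_inj.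
have -> : ord0 = 0 :> 'I_2 by exact/val_inj.
by rewrite expr0 expr1; ring.
Qed.

Lemma det_col_mx a b : \det (col_mx a b : 'M[R]_2) = cross a b.
Proof. by rewrite det2 !col_mx_row0 !col_mx_row1. Qed.

Lemma mulmx2E v B j : (v *m B) 0 j = v 0 0 * B 0 j + v 0 1 * B 1 j.
Proof.
rewrite mxE !big_ord_recl big_ord0 addr0.
by rewrite (_ : lift 0 0 = 1) //; exact/val_inj.
Qed.

Lemma mulmx_col_mx v a b : v *m (col_mx a b : 'M[R]_2) = v 0 0 *: a + v 0 1 *: b.
Proof.
by apply: vecP; rewrite mulmx2E col_mx_row0 col_mx_row1 !mxE.
Qed.

Lemma cross_mulmx a b B : cross (a *m B) (b *m B) = cross a b * \det B.
Proof. by rewrite /cross det2 !mulmx2E; ring. Qed.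

Lemma triangle_areaE x y z : triangle_area x y z = `|area2 x y z| / 2.
Proof. by rewrite /triangle_area (det_col_mx (y - x) (z - x)). Qed.

End Plane.

(** * A largest triangle yields a covering lattice *)

Section CoveringLattice.
Context {R : realType}.
Variables (K : set 'rV[R]_2) (hK : symmetric_convex_domain K).
Implicit Types (a b c x y z p q : 'rV[R]_2).

Lemma domain_combination3 (r s t : R) x y z : 0 <= r -> 0 <= s -> 0 <= t ->
  r + s + t <= 1 -> K x -> K y -> K z -> K (r *: x + s *: y + t *: z).
Proof.
move=> r0 s0 t0 rst Kx Ky Kz.
have [rs|rs] := eqVneq (r + s) 0.
  have -> : r = 0 by lra.
  have -> : s = 0 by lra.
  have -> : 0 *: x + 0 *: y + t *: z = 0 *: x + t *: z by rewrite !scale0r addr0.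
  by apply: domain_combination => //; lra.
have rs0 : 0 < r + s by rewrite lt_neqAle eq_sym rs addr_ge0.
have Kxy := domain_combination (s := r / (r + s)) (t := s / (r + s)) hK _ _ _ Kx Ky.
have -> : r *: x + s *: y + t *: z
    = (r + s) *: (r / (r + s) *: x + s / (r + s) *: y) + t *: z.
  by rewrite scalerDr !scalerA ![_ * (_ / _)]mulrC !divfK.
apply: domain_combination => //; first exact: ltW.
apply: Kxy; [by rewrite divr_ge0 // ltW|by rewrite divr_ge0 // ltW|].
by rewrite -mulrDl divff.
Qed.

(** The translates of the triangle x y z by the lattice cover the plane up to the
    translates of the reflected triangle, with vertices y, z and y + z - x. The
    points - x, - y, - z are congruent modulo the lattice, and since the origin
    has barycentric coordinates at most 1 / 2 they are congruent to a point of
    the reflected triangle. That point cuts it into three triangles, and each of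
    them is a translate of one with two vertices among x, y, z and the third
    among - x, - y, - z, hence lies in a translate of K. *)
Lemma largest_triangle_covering x y z : largest_triangle K x y z ->
  covering K (lattice (col_mx (y - x) (z - x))).
Proof.
move=> h; have M0 := largest_triangle_gt0 hK h; set M := area2 x y z in M0.
have [Kx Ky Kz _] := h; have h1 := largest_triangle_rot h.
have h2 := largest_triangle_rot h1.
have KNx := domain_opp hK Kx; have KNy := domain_opp hK Ky; have KNz := domain_opp hK Kz.
have o1 := largest_triangle_origin hK h; have o2 := largest_triangle_origin hK h1.
have o3 := largest_triangle_origin hK h2.
have d1 := largest_triangle_half hK h; have d2 := largest_triangle_half hK h1.
have d3 := largest_triangle_half hK h2; rewrite -/M in d1.
rewrite (_ : area2 y z x = M) in d2; last by rewrite /M; cross_ring.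
rewrite (_ : area2 z x y = M) in d3; last by rewrite /M; cross_ring.
have ME : M = cross y z + cross z x + cross x y by rewrite /M; cross_ring.
(* The barycentric coordinates of - x in the reflected triangle. *)
pose A := 1 - 2 * (cross y z / M); pose B := 1 - 2 * (cross z x / M).
pose C := 1 - 2 * (cross x y / M).
have Mn0 : M != 0 by rewrite gt_eqF.
have ABC : A + B + C = 1 by rewrite /A /B /C ME; field; rewrite -ME.
have [A0 B0 C0] : [/\ 0 <= A, 0 <= B & 0 <= C].
  by rewrite /A /B /C !subr_ge0 !mulrA !ler_pdivrMr // !mul1r.
have apexE : - x = A *: (y + z - x) + C *: y + B *: z.
  have -> : A *: (y + z - x) + C *: y + B *: z = (A + C) *: y + (A + B) *: z - A *: x.
    by apply: vecP; rewrite !mxE; ring.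
  rewrite /A /B /C ME.
  by apply: vecP; rewrite !mxE /cross; field; move: Mn0; rewrite ME /cross.
apply/seteqP; split => // p _.
pose s := cross (p - x) (z - x) / M; pose t := cross (y - x) (p - x) / M.
have pE : p = x + s *: (y - x) + t *: (z - x).
  rewrite /s /t /M; apply: vecP; rewrite !mxE /area2 /cross !mxE; field;
    by move: Mn0; rewrite /M /area2 /cross !mxE.
pose m := Num.floor s; pose n := Num.floor t.
have [s0 s1] : 0 <= s - m%:~R /\ s - m%:~R < 1.
  by have := floor_itv s; move=> /andP[]; rewrite -/m intrD; lra.
have [t0 t1] : 0 <= t - n%:~R /\ t - n%:~R < 1.
  by have := floor_itv t; move=> /andP[]; rewrite -/n intrD; lra.
set s' := s - _ in s0 s1; set t' := t - _ in t0 t1.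
have translate k l q : K q ->
    p = q + (m + k)%:~R *: (y - x) + (n + l)%:~R *: (z - x) ->
    [set x + v | x in K & v in lattice (col_mx (y - x) (z - x))] p.
  move=> Kq ->; exists q => //.
  exists ((m + k)%:~R *: (y - x) + (n + l)%:~R *: (z - x)); last by rewrite addrA.
  exists (\row_(i < 2) if i == 0 then m + k else n + l) => //.
  by rewrite mulmx_col_mx !mxE.
(* Modulo the lattice, p is in the triangle or in the reflected one. *)
have [st|/ltW st] := leP (s' + t') 1.
  apply: (translate 0 0 ((1 - s' - t') *: x + s' *: y + t' *: z)).
    by apply: domain_combination3 => //; lra.
  by rewrite !addr0 [LHS]pE /s' /t'; apply: vecP; rewrite !mxE; ring.
(* Which of the three parts contains p is decided by the least ratio. *)
have [||||mu [mu0 ma mb mc]] := min_ratio A0 B0 C0 ABC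
    (a := s' + t' - 1) (b := 1 - s') (c := 1 - t'); try lra.
have pE' : p = mu *: (- x) + (s' + t' - 1 - mu * A) *: (y + z - x)
  + (1 - t' - mu * C) *: y + (1 - s' - mu * B) *: z
  + m%:~R *: (y - x) + n%:~R *: (z - x).
  rewrite [X in mu *: X]apexE [LHS]pE /s' /t'; apply: vecP; rewrite !mxE; ring.
have muABC : mu * A + mu * B + mu * C = mu by rewrite -!mulrDr ABC mulr1.
case => e.
- apply: (translate 0 0 (mu *: (- x) + (1 - t' - mu * C) *: y + (1 - s' - mu * B) *: z)).
    by apply: domain_combination3 => //; lra.
  by rewrite !addr0 [LHS]pE' e subrr scale0r addr0.
- apply: (translate 1 0 (mu *: (- y) + (s' + t' - 1 - mu * A) *: z + (1 - t' - mu * C) *: x)).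
    by apply: domain_combination3 => //; lra.
  rewrite [LHS]pE' e !intrD (_ : s' + t' - 1 - mu * A = 1 - mu - (1 - t' - mu * C)); last lra.
  by apply: vecP; rewrite !mxE; ring.
- apply: (translate 0 1 (mu *: (- z) + (s' + t' - 1 - mu * A) *: y + (1 - s' - mu * B) *: x)).
    by apply: domain_combination3 => //; lra.
  rewrite [LHS]pE' e !intrD (_ : s' + t' - 1 - mu * A = 1 - mu - (1 - s' - mu * B)); last lra.
  by apply: vecP; rewrite !mxE; ring.
Qed.

End CoveringLattice.

(** * A covering lattice yields a large triangle *)

Section TorusDegree.
Context {R : realType}.
Implicit Types (W : nat -> nat -> 'rV[R]_2).

Lemma sum_nat2_telescope_periodic (N : nat) (P Q : nat -> nat -> R) (c : R) :
  (forall j, P N j = P 0%N j) -> (forall i, Q i N = Q i 0%N) ->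
  \sum_(0 <= i < N) \sum_(0 <= j < N)
     (c + (Q i j.+1 - Q i j) + (P i.+1 j - P i j)) = c * N%:R * N%:R.
Proof.
move=> PN QN.
have tele (f : nat -> R) : f N = f 0%N -> \sum_(0 <= k < N) (f k.+1 - f k) = 0.
  by move=> fN; rewrite (telescope_sumr f) // fN subrr.
rewrite (eq_bigr (fun i => c * N%:R + \sum_(0 <= j < N) (P i.+1 j - P i j))).
  rewrite big_split /= exchange_big /= [X in _ + X]big1 ?addr0; last first.
    by move=> j _; rewrite (tele (P ^~ j)).
  by rewrite big_const_nat subn0 iter_addr_0 [RHS]mulr_natr.
move=> i _; rewrite [LHS]big_split /= [X in X + _ = _]big_split /= (tele (Q i)) // addr0.
by rewrite big_const_nat subn0 iter_addr_0 (mulr_natr c).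
Qed.

(** Moving the vertices of a grid on the torus periodically changes the areas of
    its triangles, but not the sum of the signed areas: the linear and the
    quadratic terms in W telescope. This is the degree of a map of the torus
    homotopic to the identity. *)
Lemma torus_signed_area (N : nat) (h : R) W :
  (forall j, W N j = W 0%N j) -> (forall i, W i N = W i 0%N) ->
  let V i j := vec (i%:R * h) (j%:R * h) - W i j in
  \sum_(0 <= i < N) \sum_(0 <= j < N)
     (area2 (V i j) (V i.+1 j) (V i.+1 j.+1)
      + area2 (V i j) (V i.+1 j.+1) (V i j.+1))
  = 2 * h ^+ 2 * N%:R * N%:R.
Proof.
move=> WN1 WN2 V; pose g1 := vec h h; pose g2 := vec (- h) h.
pose Q i j := cross (W i.+1 j) (W i j) - cross g1 (W i j) - cross (W i j) g2.
pose P i j := - cross (W i j.+1) (W i j) + cross g1 (W i j) - cross (W i j.+1) g2.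
rewrite -(@sum_nat2_telescope_periodic N P Q).
- apply: eq_bigr => i _; apply: eq_bigr => j _.
  rewrite /P /Q /g1 /g2 /V -[i.+1%:R]natr1 -[j.+1%:R]natr1.
  rewrite /area2 /cross !mxE /=; ring.
- by move=> j; rewrite /P !WN1.
- by move=> i; rewrite /Q !WN2.
Qed.

Lemma area2_int (m n p : 'rV[int]_2) :
  exists z : int, area2 (map_mx intr m) (map_mx intr n) (map_mx intr p) = z%:~R :> R.
Proof.
exists ((n 0 0 - m 0 0) * (p 0 1 - m 0 1) - (n 0 1 - m 0 1) * (p 0 0 - m 0 0)).
by rewrite /area2 /cross !mxE !(rmorphB, rmorphM).
Qed.

Lemma cross_le (a b : 'rV[R]_2) (s t : R) : 0 <= s ->
  (forall j, `|a 0 j| <= s) -> (forall j, `|b 0 j| <= t) ->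
  `|cross a b| <= 2 * s * t.
Proof.
move=> s0 ha hb; rewrite /cross (le_trans (ler_normB _ _)) // !normrM.
have h i j : `|a 0 i| * `|b 0 j| <= s * t by exact: ler_pM.
by have := h 0 1; have := h 1 0; lra.
Qed.

(** Send each vertex of a fine periodic grid to an integer point whose translate
    of S contains it. The total signed area is positive, so some grid triangle
    goes to a triangle of positive area, which is at least 1 because its
    vertices are integer points. The three points of S that represent the
    vertices of the grid triangle form, up to an error of the order of the mesh,
    the reflection of this triangle. *)
Lemma integer_covering_triangle (S : set 'rV[R]_2) (C : R) : 0 < C ->
  (forall u, S u -> forall j, `|u 0 j| <= C) ->
  (forall u, exists2 w, S w & exists n : 'rV[int]_2, u = w + map_mx intr n) ->
  forall N : nat, (0 < N)%N -> exists a b c,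
    [/\ S a, S b, S c & 1 - (8 * C + 2) / N%:R <= area2 a b c].
Proof.
move=> C0 SC covS N N0.
pose h : R := N%:R^-1; pose G i j := vec (i%:R * h) (j%:R * h).
have hN : h * N%:R = 1 by rewrite mulVf // pnatr_eq0 -lt0n.
have h0 : 0 < h by rewrite invr_gt0 ltr0n.
have h1 : h <= 1 by rewrite invf_le1 ?ler1n ?ltr0n.
have /choice [w wP] (ij : nat * nat) : exists w, S w /\
    exists n : 'rV[int]_2, G ij.1 ij.2 = w + map_mx intr n.
  by have [w Sw nP] := covS (G ij.1 ij.2); exists w.
(* Making the choice periodic is what lets the signed areas telescope. *)
pose W i j := w (i %% N, j %% N)%N.
pose V i j := G i j - W i j.
have SW i j : S (W i j) by have [] := wP (i %% N, j %% N)%N.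
have intV i j : exists n : 'rV[int]_2, V i j = map_mx intr n.
  have [_ [n nE]] := wP (i %% N, j %% N)%N.
  exists (n + \row_(k < 2) if k == 0 then (i %/ N)%:Z else (j %/ N)%:Z).
  have modE k : k%:R * h = (k %% N)%:R * h + (k %/ N)%:R.
    by rewrite {1}(divn_eq k N) natrD natrM mulrDl addrC -mulrA [N%:R * h]mulrC hN mulr1.
  have -> : V i j = (G (i %% N) (j %% N))%N - W i j + vec (i %/ N)%:R (j %/ N)%:R.
    by rewrite /V /G (modE i) (modE j); vec_ring.
  have -> : (G (i %% N) (j %% N))%N - W i j = map_mx intr n.
    by rewrite /W; move: nE => /= ->; rewrite addrC addKr.
  by apply: vecP; rewrite !mxE /= rmorphD.
have bound i j i1 j1 i2 j2 : (i <= i1 <= i.+1)%N -> (i <= i2 <= i.+1)%N ->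
    (j <= j1 <= j.+1)%N -> (j <= j2 <= j.+1)%N ->
    0 < area2 (V i j) (V i1 j1) (V i2 j2) ->
    1 - (8 * C + 2) * h <= area2 (W i j) (W i1 j1) (W i2 j2).
  move=> hi1 hi2 hj1 hj2.
  have [n0 e0] := intV i j; have [n1 e1] := intV i1 j1; have [n2 e2] := intV i2 j2.
  have [z zE] := area2_int n0 n1 n2.
  rewrite {1}e0 {1}e1 {1}e2 zE ltr0z => z0.
  (* A positive integer is at least 1. *)
  have : 1 <= area2 (V i j) (V i1 j1) (V i2 j2).
    by rewrite e0 e1 e2 zE ler1z -gtz0_ge1.
  have step k k1 : (k <= k1 <= k.+1)%N -> `|k1%:R * h - k%:R * h| <= h.
    move=> /andP[kk1 kk2]; rewrite -mulrBl normrM (gtr0_norm h0) ler_piMl ?(ltW h0) //.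
    by rewrite -natrB // normr_nat lern1 leq_subLR addn1 kk2.
  have hG i' j' : (i <= i' <= i.+1)%N -> (j <= j' <= j.+1)%N ->
      forall k, `|(G i' j' - G i j) 0 k| <= h.
    by move=> hi hj kk; rewrite !mxE; case: ifP => _; exact: step.
  have hW i' j' : forall k, `|(W i' j' - W i j) 0 k| <= 2 * C.
    move=> kk; rewrite !mxE (le_trans (ler_normB _ _)) //.
    by have := SC _ (SW i' j') kk; have := SC _ (SW i j) kk; lra.
  have := cross_le (ltW h0) (hG _ _ hi1 hj1) (hW i2 j2).
  have := cross_le (ltW h0) (hG _ _ hi2 hj2) (hW i1 j1).
  have := cross_le (ltW h0) (hG _ _ hi1 hj1) (hG _ _ hi2 hj2).
  rewrite !ler_norml (crossC (G i2 j2 - _)) => /andP[_ b1] /andP[b2 b2'] /andP[b3 b3'].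
  have -> : area2 (V i j) (V i1 j1) (V i2 j2) = area2 (W i j) (W i1 j1) (W i2 j2)
     + cross (G i1 j1 - G i j) (G i2 j2 - G i j)
     - cross (G i1 j1 - G i j) (W i2 j2 - W i j)
     - cross (W i1 j1 - W i j) (G i2 j2 - G i j).
    by rewrite /V; cross_ring.
  have : 2 * h * h <= 2 * h by rewrite ler_piMr //; lra.
  by lra.
have [i [j [pos|pos]]] : exists i j, 
    0 < area2 (V i j) (V i.+1 j) (V i.+1 j.+1) \/ 0 < area2 (V i j) (V i.+1 j.+1) (V i j.+1).
  apply: contrapT => no.
  have WN1 j : W N j = W 0%N j by rewrite /W modnn mod0n.
  have WN2 i : W i N = W i 0%N by rewrite /W modnn mod0n.
  have e := torus_signed_area h WN1 WN2.
  have : 0 < 2 * h ^+ 2 * N%:R * N%:R :> R.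
    by rewrite !mulr_gt0 ?exprn_gt0 ?ltr0n.
  rewrite -e ltNge => /negP; apply.
  apply: sumr_le0 => i _; apply: sumr_le0 => j _.
  have [l1 l2] : ~ 0 < area2 (V i j) (V i.+1 j) (V i.+1 j.+1) /\
      ~ 0 < area2 (V i j) (V i.+1 j.+1) (V i j.+1).
    by split => pos; apply: no; exists i, j; [left|right].
  by move/negP: l1; move/negP: l2; rewrite -!leNgt /V /G; lra.
- exists (W i j), (W i.+1 j), (W i.+1 j.+1); split => //.
  by apply: bound; rewrite ?leqnn ?leqnSn.
- exists (W i j), (W i.+1 j.+1), (W i j.+1); split => //.
  by apply: bound; rewrite ?leqnn ?leqnSn.
Qed.

End TorusDegree.

(** * The critical determinant is twice the area of a largest triangle *)

Section CriticalDeterminant.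
Context {R : realType}.
Implicit Types (K : set 'rV[R]_2) (a b c x y z p q : 'rV[R]_2) (B : 'M[R]_2).

(** In the coordinates given by B the lattice is the integer lattice, and
    [integer_covering_triangle] applies to arbitrarily fine grids. *)
Lemma covering_det_le K B x y z : symmetric_convex_domain K ->
  largest_triangle K x y z -> B \in unitmx -> covering K (lattice B) ->
  `|\det B| <= area2 x y z.
Proof.
move=> hK h uB covB; set M := area2 x y z; have M0 : 0 < M := largest_triangle_gt0 hK h.
have [C C0 CK] := domain_bounded hK.
pose S : set 'rV[R]_2 := [set u | K (u *m B)].
have [D D0 DS] : exists2 D, 0 < D & forall u, S u -> forall j, `|u 0 j| <= D.
  pose D := \sum_(k < 2) \sum_(j < 2) `|invmx B k j|.
  have D0 : 0 <= D by apply: sumr_ge0 => k _; apply: sumr_ge0.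
  exists (C * D + 1); first by have := mulr_ge0 (ltW C0) D0; lra.
  move=> u Su j; rewrite -[u](mulmxK uB) [X in `|X|]mxE.
  apply: (@le_trans _ _ (C * D)); last by lra.
  rewrite (le_trans (ler_norm_sum _ _ _)) // mulr_sumr ler_sum // => k _.
  rewrite normrM mulr_sumr (bigD1 j) //= ler_wpDr //.
    by apply: sumr_ge0 => *; rewrite mulr_ge0 // ltW.
  by rewrite ler_wpM2r //; exact: CK.
have covS u : exists2 w, S w & exists n : 'rV[int]_2, u = w + map_mx intr n.
  have : [set: 'rV[R]_2] (u *m B) by [].
  rewrite -covB => -[k Kk [_ [n _ <-] e]].
  exists (k *m invmx B); first by rewrite /S /= mulmxKV.
  exists n; apply: (can_inj (mulmxK uB)).
  by rewrite mulmxDl mulmxKV.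
rewrite leNgt; apply/negP => MB.
have dB : 0 < `|\det B| by exact: lt_trans MB.
pose e := 1 - M / `|\det B|; have e0 : 0 < e by rewrite subr_gt0 ltr_pdivrMr // mul1r.
pose N := (Num.truncn ((8 * D + 2) / e)).+1.
have eN : (8 * D + 2) / N%:R < e.
  rewrite ltr_pdivrMr ?ltr0n // [e * _]mulrC -ltr_pdivrMr //.
  by rewrite /N truncnS_gt.
have [//|a [b [c [Sa Sb Sc]]]] := integer_covering_triangle D0 DS covS (N := N).
have := largest_triangle_norm h Sa Sb Sc.
rewrite /area2 -!mulmxBl cross_mulmx normrM -/(area2 a b c) -/(area2 x y z) -/M.
rewrite -ler_pdivlMr // => le1 le2.
have := ler_norm (area2 a b c).
by move: eN; rewrite /e; lra.
Qed.

Theorem critical_determinantE K x y z : symmetric_convex_domain K ->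
  largest_triangle K x y z -> critical_determinant K = area2 x y z.
Proof.
move=> hK h; have M0 := largest_triangle_gt0 hK h.
rewrite /critical_determinant; set S := [set _ | _ in _].
have Sub : ubound S (area2 x y z).
  by move=> _ [B [uB covB] <-]; exact: (covering_det_le hK h uB covB).
have SM : S (area2 x y z).
  exists (col_mx (y - x) (z - x)); last by rewrite det_col_mx (gtr0_norm M0).
  split; last exact: largest_triangle_covering.
  by rewrite unitmxE det_col_mx unitfE (lt0r_neq0 M0).
apply: le_anti; rewrite ge_sup //=; last by exists (area2 x y z).
by apply: ub_le_sup => //; exists (area2 x y z).
Qed.

End CriticalDeterminant.

(** * Adjoining a point to a domain *)

Section Extension.
Context {R : realType}.
Variables (K : set 'rV[R]_2) (hK : symmetric_convex_domain K).
Implicit Types (a b c k x y z p q : 'rV[R]_2).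

(** The convex hull of K, p and - p: a point of the hull has weights on p and
    - p, of which only the difference t matters, and the rest is a multiple of a
    point of K because K is star-shaped about the origin. *)
Definition adjoin p : set 'rV[R]_2 :=
  [set (1 - `|kt.2|) *: kt.1 + kt.2 *: p | kt in K `*` `[(-1 : R), 1]%classic].

Lemma adjoinP p v : adjoin p v <->
  exists k (t : R), [/\ K k, `|t| <= 1 & v = (1 - `|t|) *: k + t *: p].
Proof.
split=> [[[k t] /= [Kk]]|[k [t [Kk t1 ->]]]].
  by rewrite in_itv /= -ler_norml => t1 <-; exists k, t.
by exists (k, t) => //=; split => //; rewrite in_itv /= -ler_norml.
Qed.

Lemma adjoin_sub p : K `<=` adjoin p.
Proof.
move=> k Kk; apply/adjoinP; exists k, 0.
by rewrite normr0 subr0 scale1r scale0r addr0.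
Qed.

Lemma adjoin_point p : adjoin p p.
Proof.
apply/adjoinP; exists 0, 1; rewrite normr1 subrr scaler0 scale1r add0r.
by split => //; exact: domain0.
Qed.

Lemma domain_cone (r s t : R) x y : 0 <= r -> 0 <= s -> r + s <= t ->
  K x -> K y -> exists2 z, K z & r *: x + s *: y = t *: z.
Proof.
move=> r0 s0 rst Kx Ky; have [t0|t0] := eqVneq t 0.
  exists 0; first exact: domain0.
  have -> : r = 0 by lra.
  have -> : s = 0 by lra.
  by rewrite !scale0r scaler0 addr0.
have t1 : 0 < t by rewrite lt_neqAle eq_sym t0; lra.
exists (r / t *: x + s / t *: y).
  apply: domain_combination => //; rewrite ?divr_ge0 // ?(ltW t1) //.
  by rewrite -mulrDl ler_pdivrMr // mul1r.
by rewrite scalerDr !scalerA ![t * _]mulrC !divfK.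
Qed.

Lemma adjoin_domain p : symmetric_convex_domain (adjoin p).
Proof.
have [_ cK [c Kc] _] := hK; split.
- move=> x y l; rewrite !inE => /adjoinP [k [s [Kk s1 ->]]] /adjoinP [k' [s' [Kk' s1' ->]]].
  apply/adjoinP; change (exists k0 t, [/\ K k0, `|t| <= 1 &
    l%:num *: ((1 - `|s|) *: k + s *: p) + (1 - l%:num) *: ((1 - `|s'|) *: k' + s' *: p)
    = (1 - `|t|) *: k0 + t *: p]).
  have l0 : 0 <= l%:num by [].
  have l1 : 0 <= 1 - l%:num by rewrite subr_ge0.
  move: (l%:num) l0 l1 => r r0 r1.
  have le1 : `|r * s + (1 - r) * s'| <= r * `|s| + (1 - r) * `|s'|.
    by rewrite (le_trans (ler_normD _ _)) // !normrM (ger0_norm r0) (ger0_norm r1).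
  have a1 : r * `|s| <= r by rewrite ler_piMr.
  have a2 : (1 - r) * `|s'| <= 1 - r by rewrite ler_piMr.
  have [z Kz zE] : exists2 z, K z &
      (r * (1 - `|s|)) *: k + ((1 - r) * (1 - `|s'|)) *: k'
      = (1 - `|r * s + (1 - r) * s'|) *: z.
    by apply: domain_cone => //; rewrite ?mulr_ge0 ?subr_ge0 //; lra.
  exists z, (r * s + (1 - r) * s'); split => //; first by lra.
  by rewrite -zE; apply: vecP; rewrite !mxE; ring.
- apply: continuous_compact; last first.
    by apply: compact_setX => //; exact: segment_compact.
  apply: continuous_subspaceT => -[k t].
  apply: (@continuousD _ _ _ (fun kt : 'rV[R]_2 * R => (1 - `|kt.2|) *: kt.1)
     (fun kt : 'rV[R]_2 * R => kt.2 *: p)).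
  + apply: (@continuousZ _ _ _ (fun kt : 'rV[R]_2 * R => 1 - `|kt.2|) (fun kt : 'rV[R]_2 * R => kt.1)).
    * apply: (@continuousB R R^o _ (fun=> 1) (fun kt : 'rV[R]_2 * R => `|kt.2|)).
        exact: cvg_cst.
      apply: (@continuous_comp _ _ _ (fun kt : 'rV[R]_2 * R => kt.2) Num.norm); first exact: cvg_snd.
      exact: norm_continuous.
    * exact: cvg_fst.
  + apply: (@continuousZ _ _ _ (fun kt : 'rV[R]_2 * R => kt.2) (fun=> p)).
      exact: cvg_snd.
    exact: cvg_cst.
- by exists c; apply: (interiorS (@adjoin_sub p)).
- apply/seteqP; split=> [v /adjoinP [k [t [Kk t1 ->]]]|_ [v /adjoinP [k [t [Kk t1 ->]]] <-]].
    exists ((1 - `|t|) *: - k + - t *: p).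
      by apply/adjoinP; exists (- k), (- t); rewrite normrN; split => //; exact: domain_opp.
    by rewrite scalerN scaleNr -opprD opprK.
  by apply/adjoinP; exists (- k), (- t); rewrite normrN scalerN scaleNr opprD; split => //; exact: domain_opp.
Qed.

End Extension.

(** * Largest triangles of an inextensible domain *)

Section Inextensible.
Context {R : realType}.
Variables (K : set 'rV[R]_2) (hK : symmetric_convex_domain K).
Implicit Types (a b c k x y z p q u v w : 'rV[R]_2).
Variables (tx ty tz : 'rV[R]_2) (hT : largest_triangle K tx ty tz).
Let M := area2 tx ty tz.

(** The signed area is affine in each vertex, so it increases towards one end of
    the segment on which v lies. *)
Lemma adjoin_extreme p v y z : adjoin K p v ->
  exists2 v', K v' \/ v' = p \/ v' = - p & area2 v y z <= area2 v' y z.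
Proof.
move=> /adjoinP [k [t [Kk t1 ->]]].
have [e eP tE] : exists2 e, e = p \/ e = - p & t *: p = (1 - (1 - `|t|)) *: e.
  rewrite opprB addrCA subrr addr0; have [t0|t0] := lerP 0 t.
    by exists p; [left|rewrite ger0_norm].
  by exists (- p); [right|rewrite ltr0_norm // scalerN scaleNr opprK].
rewrite tE area2_convex; have [ke|/ltW ek] := leP (area2 k y z) (area2 e y z).
  exists e; first by right.
  have : (1 - `|t|) * area2 k y z <= (1 - `|t|) * area2 e y z.
    by rewrite ler_wpM2l // subr_ge0.
  by lra.
exists k; first by left.
have : `|t| * area2 e y z <= `|t| * area2 k y z by rewrite ler_wpM2l.
by lra.
Qed.

Hypothesis inextK : inextensible K.

(** Adjoining p increases the largest area, and a triangle that shows it has its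
    vertices in K or among p and - p, one of them outside K; by symmetry that one
    is p. A second vertex - p is harmless: the triangles p, - p, c and p, - c, c
    have the same area. *)
Lemma inextensible_apex p : ~ K p ->
  exists b c, [/\ K b, K c & M < area2 p b c].
Proof.
move=> nKp; have M0 : 0 < M := largest_triangle_gt0 hK hT.
have hK' := adjoin_domain hK p.
have [x [y [z T']]] := largest_triangle_exists hK'.
have [Kx Ky Kz T'max] := T'.
have Mlt : M < area2 x y z.
  have [Ktx Kty Ktz _] := hT.
  rewrite lt_neqAle T'max ?andbT; try exact: adjoin_sub.
  apply/eqP => e; apply: inextK; exists (adjoin K p); split => //.
  - exact: adjoin_sub.
  - by move=> KE; apply: nKp; rewrite -KE; exact: adjoin_point.
  - by rewrite (critical_determinantE hK hT) (critical_determinantE hK' T').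
pose S v := K v \/ v = p \/ v = - p.
have SN v : S v -> S (- v).
  by case=> [Kv|[->|->]]; [left; exact: domain_opp|right; right|right; left; rewrite opprK].
have [a [b [c [Sa Sb Sc abc]]]] : exists a b c, [/\ S a, S b, S c & M < area2 a b c].
  have [x' Sx xx'] := adjoin_extreme y z Kx.
  have [y' Sy yy'] := adjoin_extreme z x' Ky.
  have [z' Sz zz'] := adjoin_extreme x' y' Kz.
  exists x', y', z'; split => //.
  apply: lt_le_trans Mlt _; apply: le_trans xx' _.
  rewrite -(area2_rot x' y z) (area2_rot z' x' y'); apply: le_trans yy' _.
  by rewrite -(area2_rot y' z x').
have apexS b' c' : S b' -> S c' -> M < area2 p b' c' ->
    exists b c, [/\ K b, K c & M < area2 p b c].
  case=> [Kb|[->|->]] [Kc|[->|->]].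
  - by exists b', c'.
  - by rewrite (_ : area2 p b' p = 0); [lra|cross_ring].
  - move=> lt; exists b', (- b'); split => //; first exact: domain_opp.
    by rewrite (_ : area2 p b' (- b') = area2 p b' (- p)) //; cross_ring.
  - by rewrite (_ : area2 p p c' = 0); [lra|cross_ring].
  - by rewrite (_ : area2 p p p = 0); [lra|cross_ring].
  - by rewrite (_ : area2 p p (- p) = 0); [lra|cross_ring].
  - move=> lt; exists (- c'), c'; split => //; first exact: domain_opp.
    by rewrite (_ : area2 p (- c') c' = area2 p (- p) c') //; cross_ring.
  - by rewrite (_ : area2 p (- p) p = 0); [lra|cross_ring].
  - by rewrite (_ : area2 p (- p) (- p) = 0); [lra|cross_ring].
have apexS' a' b' c' : S b' -> S c' -> a' = p \/ a' = - p -> M < area2 a' b' c' ->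
    exists b c, [/\ K b, K c & M < area2 p b c].
  move=> Sb' Sc' [->|->]; first exact: apexS.
  by rewrite -area2N opprK; apply: apexS; exact: SN.
case: (Sa) => [Ka|ap]; last exact: apexS' Sb Sc ap abc.
case: (Sb) => [Kb|bp]; last by apply: apexS' Sc Sa bp _; rewrite area2_rot.
case: (Sc) => [Kc|cp]; last by apply: apexS' Sa Sb cp _; rewrite -area2_rot.
by have [_ _ _ /(_ _ _ _ Ka Kb Kc)] := hT; rewrite leNgt abc.
Qed.

(** Apply [inextensible_apex] to points outside K that tend to x from the
    direction w. In the limit x is the apex of a largest triangle; moreover the
    approximating points are higher than x above the opposite side b c, which
    gives the sign. The correction e *: u lets w be tangent to K. *)
Lemma inextensible_apex_limit x w u : K x ->
  (forall e : R, 0 < e -> ~ K (x + e *: (w + e *: u))) ->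
  exists b c, [/\ K b, K c, area2 x b c = M & 0 <= cross w (b - c)].
Proof.
move=> Kx out; have [_ cK _ _] := hK; have K0 := domain0 hK.
(* The conclusion says that the maximum of phi is nonnegative. *)
pose phi (bc : 'rV[R]_2 * 'rV[R]_2) :=
  Num.min (area2 x bc.1 bc.2 - M) (cross w (bc.1 - bc.2)).
have [|||[b c] [Kb Kc] bcmax] := @compact_max R _ (K `*` K) phi.
- by exists (0, 0).
- exact: compact_setX.
- move=> t; apply: (continuous_min (f := fun bc : 'rV[R]_2 * 'rV[R]_2 => area2 x bc.1 bc.2 - M) (g := fun bc : 'rV[R]_2 * 'rV[R]_2 => cross w (bc.1 - bc.2))).
    apply: (@continuousB R R^o _ (fun bc : 'rV[R]_2 * 'rV[R]_2 => area2 x bc.1 bc.2) (fun=> M)).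
      by apply: continuous_area2 => ?; [exact: cvg_cst|exact: cvg_fst|exact: cvg_snd].
    exact: cvg_cst.
  apply: (@continuous_cross _ _ (fun=> w) (fun bc : 'rV[R]_2 * 'rV[R]_2 => bc.1 - bc.2)) => ?.
    exact: cvg_cst.
  by apply: continuousB; [exact: cvg_fst|exact: cvg_snd].
have [C C0 CK] := domain_bounded hK.
have bound v : exists2 D : R, 0 < D & forall b c, K b -> K c -> `|cross v (b - c)| <= D.
  exists (2 * (`|v 0 0| + `|v 0 1|) * (2 * C) + 1).
    by rewrite ltr_wpDl // !mulr_ge0 ?addr_ge0 //; lra.
  move=> b' c' Kb' Kc'; apply: le_trans (_ : 2 * (`|v 0 0| + `|v 0 1|) * (2 * C) <= _); last lra.
  apply: cross_le; first by rewrite addr_ge0.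
    case=> -[|[|//]] h.
      by rewrite (_ : Ordinal h = 0) ?lerDl //; apply/val_inj.
    by rewrite (_ : Ordinal h = 1) ?lerDr //; apply/val_inj.
  move=> j; rewrite !mxE (le_trans (ler_normB _ _)) //.
  by have := CK _ Kb' 0 j; have := CK _ Kc' 0 j; lra.
have [D D0 hD] := bound u; have [D1 D10 hD1] := bound w.
have phi0 : 0 <= phi (b, c).
  rewrite leNgt; apply/negP => phi0.
  pose e := Num.min 1 (- phi (b, c) / (2 * (D + D1))).
  have e0 : 0 < e by rewrite lt_min ltr01 divr_gt0 // ?oppr_gt0 //; lra.
  have e1 : e <= 1 by rewrite ge_min lexx.
  have e2 : e * (2 * (D + D1)) <= - phi (b, c).
    by rewrite -ler_pdivlMr ?ge_min ?lexx ?orbT //; lra.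
  have [b' [c' [Kb' Kc' lt]]] := inextensible_apex (out e e0).
  have := bcmax (b', c') (conj Kb' Kc').
  have lt' : area2 x b' c' <= M by have [_ _ _] := hT; apply.
  have := hD _ _ Kb' Kc'; have := hD1 _ _ Kb' Kc'.
  have := area2_apex (x + e *: (w + e *: u)) x b' c'.
  rewrite (_ : x + e *: (w + e *: u) - x = e *: (w + e *: u)); last by rewrite addrC addKr.
  rewrite crossZl crossDl crossZl !ler_norml => eqA /andP[w1 w2] /andP[u1 u2].
  have s1 : 0 < cross w (b' - c') + e * cross u (b' - c').
    by rewrite -(pmulr_rgt0 _ e0) -eqA; lra.
  have s2 : e * cross u (b' - c') <= e * D by rewrite ler_pM2l.
  have s3 : e * (cross w (b' - c') + e * cross u (b' - c')) <= e * (D1 + D).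
    rewrite ler_pM2l // lerD //; apply: le_trans s2 _; rewrite ler_piMl //; lra.
  have s4 : e * (D + D1) = e * D + e * D1 by rewrite mulrDr.
  have s5 : 0 < e * D by rewrite mulr_gt0.
  have s6 : 0 < e * D1 by rewrite mulr_gt0.
  rewrite {1}/phi /= ge_min => /orP[]; lra.
move: phi0; rewrite /phi le_min /= subr_ge0 => /andP[h1 h2].
exists b, c; split => //; apply: le_anti; rewrite h1 andbT.
by have [_ _ _] := hT; apply.
Qed.

End Inextensible.

(** * Exchanging vertices of two largest triangles *)

Section Exchange.
Context {R : realType}.
Variables (K : set 'rV[R]_2) (hK : symmetric_convex_domain K).
Implicit Types (a b c p q r x y z : 'rV[R]_2).

(** For a symmetric convex domain these are the boundary points. *)
Definition radially_extreme p : Prop := K p /\ forall t : R, 1 < t -> ~ K (t *: p).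

Lemma radially_extremeN p : radially_extreme p -> radially_extreme (- p).
Proof.
move=> [Kp out]; split; first exact: domain_opp.
by move=> t t1 Kt; apply: (out t t1); rewrite -[t *: p]opprK -scalerN; exact: domain_opp.
Qed.

Lemma radially_extreme_neq0 p : radially_extreme p -> p != 0.
Proof.
move=> [_ out]; apply/eqP => p0; apply: (out 2); first by lra.
by rewrite p0 scaler0; exact: domain0.
Qed.

Lemma largest_triangle_apex_gt0 x y z :
  largest_triangle K x y z -> 0 < cross x (y - z).
Proof.
move=> h; have M0 := largest_triangle_gt0 hK h.
have := largest_triangle_half hK h.
by rewrite (_ : cross x (y - z) = area2 x y z - cross y z); [lra|cross_ring].
Qed.

(** The apex of a largest triangle is strictly above the line through the origin
    parallel to the base, so that scaling it up would increase the area. *)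
Lemma largest_triangle_extreme x y z :
  largest_triangle K x y z -> radially_extreme x.
Proof.
move=> h; have := largest_triangle_apex_gt0 h; have [Kx Ky Kz hm] := h.
move=> pos; split => // t t1 Kt.
have := hm _ _ _ Kt Ky Kz; rewrite -subr_le0 area2_apex.
rewrite -[X in _ - X]scale1r -scalerBl crossZl pmulr_lle0 //; lra.
Qed.

Lemma radially_extreme_parallel p q : radially_extreme p -> radially_extreme q ->
  cross p q = 0 -> p = q \/ p = - q.
Proof.
move=> ep eq pq; have q0 := radially_extreme_neq0 eq; have [Kp outp] := ep; have [Kq outq] := eq.
have [s sE] : exists s : R, p = s *: q.
  have [c0|c0] := eqVneq (q 0 0) 0.
    have c1 : q 0 1 != 0.
      by apply: contraNneq q0 => c1; apply/eqP/vecP; rewrite !mxE.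
    exists (p 0 1 / q 0 1); apply: vecP; rewrite !mxE ?divfK // c0 mulr0.
    move: pq; rewrite /cross c0 mulr0 subr0 => /eqP.
    by rewrite mulf_eq0 (negPf c1) orbF => /eqP.
  exists (p 0 0 / q 0 0); apply: vecP; rewrite !mxE ?divfK //.
  by move: pq => /eqP; rewrite /cross subr_eq0 mulrAC => /eqP ->; rewrite mulfK.
have bound (l : R) a b : radially_extreme a -> K b -> b = l *: a -> `|l| <= 1.
  move=> [Ka outa] Kb bE; rewrite leNgt; apply/negP => l1.
  apply: (outa `|l|) => //; have [l0|l0] := lerP 0 l.
    by rewrite ger0_norm // -bE.
  by rewrite ltr0_norm // scaleNr -bE; exact: domain_opp.
have s1 := bound _ _ _ eq Kp sE.
have s0 : s != 0.
  by apply: contraNneq (radially_extreme_neq0 ep) => s0; rewrite sE s0 scale0r.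
have s2 : `|s^-1| <= 1 by apply: (bound _ _ _ ep Kq); rewrite sE scalerA mulVf // scale1r.
have : `|s| = 1.
  apply: le_anti; rewrite s1 /= -[1]invr1 -lef_pV2 ?posrE ?normr_gt0 ?ltr01 //.
  by rewrite invrK -normfV.
by move/eqP; rewrite eqr_norml ler01 andbT => /orP[]/eqP sE'; [left|right];
  rewrite sE sE' ?scale1r ?scaleN1r.
Qed.

(** Since q lies in the angle between p and r, the multiple of q on the segment
    p r is in K, so it is not beyond q. *)
Lemma cross_subadd p q r : K p -> radially_extreme q -> K r ->
  0 <= cross p q -> 0 <= cross q r -> cross p r <= cross p q + cross q r.
Proof.
move=> Kp eq Kr pq qr; have [Kq out] := eq; set S := cross p q + cross q r.
rewrite leNgt; apply/negP => lt.
have comb := cross_combination p q r.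
have [S0|S0] := eqVneq S 0.
  have q0 : cross q r = 0 by rewrite /S in S0; lra.
  have p0 : cross p q = 0 by rewrite /S in S0; lra.
  move: comb; rewrite q0 p0 !scale0r addr0 => /esym/eqP.
  rewrite scaler_eq0 (negPf (radially_extreme_neq0 eq)) orbF => /eqP e.
  by move: lt; rewrite e S0 ltxx.
have Sp : 0 < S by rewrite lt_neqAle eq_sym S0 addr_ge0.
apply: (out (cross p r / S)); first by rewrite ltr_pdivlMr // mul1r.
rewrite mulrC -scalerA -comb scalerDr !scalerA.
apply: domain_combination => //; rewrite ?mulr_ge0 ?invr_ge0 ?(ltW Sp) //.
by rewrite -mulrDr [X in _ * X]addrC mulVf.
Qed.

(** Along half a turn of the boundary the points p, p', r, r', - p, - p' are in
    convex position, and the directions of successive chords turn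
    counterclockwise from p' - p to its opposite; r' - r is in between. With
    a = cross p r' - cross p r and d = cross p' r - cross p r, the product of the
    claim with cross p r is cross p p' * cross r r' + a * d by the
    Grassmann-Pluecker relation, while |a| <= cross r r' and |d| <= cross p p' by
    [cross_subadd]. The other alternative is the mirror image. *)
Lemma turning p p' r r' :
  radially_extreme p -> radially_extreme p' -> radially_extreme r -> radially_extreme r' ->
  0 <= cross p p' -> 0 <= cross p' r -> 0 <= cross r r' -> 0 <= cross p r' ->
  0 < cross p r \/ 0 < cross p' r' ->
  0 <= cross (p' - p) (r' - r).
Proof.
move=> ep ep' er er' N D B A CE.
have eNp := radially_extremeN ep; have eNp' := radially_extremeN ep'.
have [[Kp _] [Kp' _] [Kr _] [Kr' _]] := And4 ep ep' er er'.
have [[KNp _] [KNp' _]] := conj eNp eNp'.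
have pl := cross_pluecker p p' r r'.
rewrite !(crossBl, crossBr).
have sq (n b s t : R) : 0 <= n -> 0 <= b -> - b <= s <= b -> - n <= t <= n ->
    0 <= n * b + s * t.
  move=> n0 b0 hs ht; have : `|s * t| <= b * n.
    by rewrite normrM ler_pM // ler_norml.
  by rewrite ler_norml mulrC => /andP[]; lra.
case: CE => [C|E].
- have c1 := cross_subadd Kp ep' Kr N D.
  have c2 := cross_subadd Kp er Kr' (ltW C) B.
  have c3 : cross r (- p) <= cross r r' + cross r' (- p).
    by apply: cross_subadd => //; rewrite crossNr crossC opprK.
  have c4 : cross r (- p') <= cross r (- p) + cross (- p) (- p').
    apply: cross_subadd => //; first by rewrite crossNr crossC opprK ltW.
    by rewrite crossNr crossNl opprK.
  rewrite !crossNr (crossC r p) (crossC r' p) in c3.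
  rewrite !(crossNr, crossNl) (crossC r p) (crossC r p') in c4.
  rewrite -(pmulr_rge0 _ C).
  have := sq (cross p p') (cross r r') (cross p r' - cross p r) (cross p' r - cross p r) N B.
  set X := cross p r * _; move=> h.
  apply: le_trans (h _ _) _; [lra|lra|].
  by rewrite /X le_eqVlt; apply/orP; left; apply/eqP; move: pl; lra.
- have c1 := cross_subadd Kp ep' Kr' N (ltW E).
  have c2 : cross r' (- p') <= cross r' (- p) + cross (- p) (- p').
    apply: cross_subadd => //; first by rewrite crossNr crossC opprK.
    by rewrite crossNr crossNl opprK.
  have c3 := cross_subadd Kp' er Kr' D B.
  have c4 : cross r (- p') <= cross r r' + cross r' (- p').
    apply: cross_subadd => //; by rewrite crossNr crossC opprK ltW.
  rewrite !(crossNr, crossNl) (crossC r' p') (crossC r' p) in c2.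
  rewrite !crossNr (crossC r' p') (crossC r p') in c4.
  rewrite -(pmulr_rge0 _ E).
  have := sq (cross p p') (cross r r') (cross p' r' - cross p' r) (cross p' r' - cross p r') N B.
  set X := cross p' r' * _; move=> h.
  apply: le_trans (h _ _) _; [lra|lra|].
  by rewrite /X le_eqVlt; apply/orP; left; apply/eqP; move: pl; lra.
Qed.

Lemma largest_triangle_neq x y z : largest_triangle K x y z ->
  [/\ x <> y, y <> z & z <> x].
Proof.
move=> h; have M0 := largest_triangle_gt0 hK h.
by split => e; move: M0; rewrite e (_ : area2 _ _ _ = 0) ?ltxx //; cross_ring.
Qed.

(** If x, x', y', y follow each other within half a turn, then the two triangles
    are not ordered in the same way around the boundary, and passing to the
    smaller and to the larger vertex on each side does not decrease the sum of
    the areas, since chord directions turn ([turning]). As the sum is already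
    the largest possible one, both new triangles are largest. Which of them gets
    z is decided by the order of z and z'. *)
Lemma exchange x y z x' y' z' :
  largest_triangle K x y z -> largest_triangle K x' y' z' ->
  0 <= cross x x' -> 0 < cross x' y' -> 0 <= cross y' y ->
  0 <= cross x y' -> 0 <= cross x' y ->
  let M := area2 x y z in
  (area2 x y' z = M /\ area2 x' y z' = M) \/ (area2 x y' z' = M /\ area2 x' y z = M).
Proof.
move=> T T' xx' x'y' y'y xy' x'y M.
have eM : area2 x' y' z' = M := largest_triangle_uniq T T'.
have [[xy yz zx] [x'y'n y'z'n z'x'n]] := conj (largest_triangle_neq T) (largest_triangle_neq T').
have [Kx Ky Kz max] := T; have [Kx' Ky' Kz' _] := T'.
have [e|nx] := pselect (x = x'); first by right; split; [rewrite e|rewrite -e].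
have [e|ny] := pselect (y = y'); first by left; split; [rewrite -e|rewrite e].
have T1 := largest_triangle_rot T; have T2 := largest_triangle_rot T1.
have T1' := largest_triangle_rot T'; have T2' := largest_triangle_rot T1'.
have [ex ey ez] := And3 (largest_triangle_extreme T) (largest_triangle_extreme T1) (largest_triangle_extreme T2).
have [ex' ey' ez'] := And3 (largest_triangle_extreme T') (largest_triangle_extreme T1') (largest_triangle_extreme T2').
have [Oyz Ozx Oxy] := And3 (largest_triangle_origin hK T) (largest_triangle_origin hK T1) (largest_triangle_origin hK T2).
have [Oyz' Ozx' _] := And3 (largest_triangle_origin hK T') (largest_triangle_origin hK T1') (largest_triangle_origin hK T2').
have par := radially_extreme_parallel.
have X : 0 <= cross (x' - x) (y - y').
  apply: turning => //; first exact: ltW.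
  have [C0|C0] := eqVneq (cross x y') 0; last by left; rewrite lt_neqAle eq_sym C0.
  have [E0|E0] := eqVneq (cross x' y) 0; last by right; rewrite lt_neqAle eq_sym E0.
  (* Both vanish only in the degenerate case y = y' = - x. *)
  exfalso; have [e|e] := par _ _ ex ey' C0.
    by move: x'y' xx'; rewrite -e crossC; lra.
  have := cross_pluecker x x' y' y; rewrite C0 E0 mul0r => pl.
  have A0 : cross x y = 0.
    have := mulr_ge0 xx' y'y => h; have h2 : cross x y * cross x' y' = 0.
      by have := mulr_ge0 Oxy (ltW x'y'); lra.
    by move/eqP: h2; rewrite mulf_eq0 (gt_eqF x'y') orbF => /eqP.
  by have [//|e2] := par _ _ ex ey A0; apply: ny; apply: oppr_inj; rewrite -e -e2.
have [zz|/ltW zz] := lerP 0 (cross z' z).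
- have CE : cross x' y' * cross z' x = cross x y' * cross z' x' + cross y' z' * cross x x'.
    by rewrite /cross; ring.
  have C : 0 < cross z' x.
    rewrite lt_neqAle; apply/andP; split; last first.
      by rewrite -(pmulr_rge0 _ x'y') CE addr_ge0 // mulr_ge0.
    apply/eqP => /esym C0; have [e|e] := par _ _ ez' ex C0.
      have B0 : cross x y' = 0 by move: Oyz' xy'; rewrite e (crossC y'); lra.
      have [e2|e2] := par _ _ ex ey' B0; first by apply: y'z'n; rewrite e e2.
      have : cross x y = 0.
        by move: y'y; rewrite -[y']opprK -e2 crossNl; lra.
      move=> /(par _ _ ex ey)[//|e3]; apply: ny; apply: oppr_inj.
      by rewrite -e2 -e3.
    have : cross x x' = 0 by move: Ozx'; rewrite e crossNl; lra.
    move=> /(par _ _ ex ex')[//|e2]; apply: z'x'n.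
    by rewrite e e2 opprK.
  have Z : 0 <= cross (z - z') (x' - x) by apply: turning => //; left.
  have sum : area2 x y' z' + area2 x' y z
     = M + area2 x' y' z' + cross (x' - x) (y - y') + cross (z - z') (x' - x).
    by rewrite /M; cross_ring.
  have m1 := max _ _ _ Kx Ky' Kz'; have m2 := max _ _ _ Kx' Ky Kz.
  by right; rewrite /M in sum m1 m2 eM *; split; lra.
- have CE : cross x' y' * cross y z' = cross z' x' * cross y' y + cross x' y * cross y' z'.
    by rewrite /cross; ring.
  have {}zz : 0 <= cross z z' by rewrite crossC; lra.
  have E : 0 < cross y z'.
    rewrite lt_neqAle; apply/andP; split; last first.
      by rewrite -(pmulr_rge0 _ x'y') CE addr_ge0 // mulr_ge0.
    apply/eqP => /esym E0; have [e|e] := par _ _ ey ez' E0.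
      have : cross x' y = 0 by move: Ozx'; rewrite -e crossC; lra.
      move=> /(par _ _ ex' ey)[e2|e2]; first by apply: z'x'n; rewrite e2 e.
      have : cross x x' = 0 by move: xx'; rewrite e2 crossNr; lra.
      by move=> /(par _ _ ex ex')[//|e3]; apply: xy; rewrite e3 e2 opprK.
    have : cross y' y = 0 by move: Oyz'; rewrite -[z']opprK -e crossNr; lra.
    move=> /(par _ _ ey' ey)[/esym //|e2]; apply: y'z'n.
    by rewrite e2 e opprK.
  have Y : 0 <= cross (y - y') (z' - z) by apply: turning => //; right.
  have sum : area2 x y' z + area2 x' y z'
     = M + area2 x' y' z' + cross (x' - x) (y - y') + cross (y - y') (z' - z).
    by rewrite /M; cross_ring.
  have m1 := max _ _ _ Kx Ky' Kz; have m2 := max _ _ _ Kx' Ky Kz'.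
  by left; rewrite /M in sum m1 m2 eM *; split; lra.
Qed.

End Exchange.

(** * Bases parallel to a given direction *)

Section ParallelBase.
Context {R : realType}.
Variables (K : set 'rV[R]_2) (hK : symmetric_convex_domain K).
Implicit Types (a b c p q r u v w x y z : 'rV[R]_2).
Variables (tx ty tz : 'rV[R]_2) (hT : largest_triangle K tx ty tz).
Let M := area2 tx ty tz.
Let M_gt0 : 0 < M := largest_triangle_gt0 hK hT.
Hypothesis inextK : inextensible K.

Variables (x w : 'rV[R]_2) (Kx : K x).

(** The sides opposite to the apex x in the largest triangles. Their description
    by an equation is the one that passes to limits and convex combinations. *)
Definition base y z : Prop := [/\ K y, K z & area2 x y z = M].

Lemma baseP y z : base y z -> largest_triangle K x y z.
Proof.
by move=> [Ky Kz e]; split => // a b c *; rewrite e; case: hT => _ _ _; apply.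
Qed.

Lemma base_le y z : K y -> K z -> area2 x y z <= M.
Proof. by move=> *; case: hT => _ _ _; apply. Qed.

Hypothesis no_parallel_base : forall y z, base y z -> cross w (y - z) != 0.

(** Bases that share an end point form a convex set, because the area is affine
    in the other one; so their direction cannot cross w without meeting it. *)
Lemma base_side_z y z z' : base y z -> base y z' ->
  0 < cross w (y - z) * cross w (y - z').
Proof.
move=> [Ky Kz e] [_ Kz' e']; rewrite ltNge; apply/negP => /convex_zero [t t01 t0].
have /no_parallel_base : base y (t *: z + (1 - t) *: z').
  split => //; first exact: domain_segment.
  by rewrite -area2_rot -area2_rot area2_convex !(area2_rot y) !(area2_rot x) e e'; ring.
by rewrite -t0 (_ : cross _ _ = t * cross w (y - z) + (1 - t) * cross w (y - z')) ?eqxx //; cross_ring.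
Qed.

Lemma base_side_y y y' z : base y z -> base y' z ->
  0 < cross w (y - z) * cross w (y' - z).
Proof.
move=> [Ky Kz e] [Ky' _ e']; rewrite ltNge; apply/negP => /convex_zero [t t01 t0].
have /no_parallel_base : base (t *: y + (1 - t) *: y') z.
  split => //; first exact: domain_segment.
  by rewrite -area2_rot area2_convex !(area2_rot x) e e'; ring.
by rewrite -t0 (_ : cross _ _ = t * cross w (y - z) + (1 - t) * cross w (y' - z)) ?eqxx //; cross_ring.
Qed.

(** Two bases whose directions are separated by that of w. *)
Definition opposite_bases y1 z1 y2 z2 : Prop :=
  [/\ base y1 z1, base y2 z2 & cross w (y1 - z1) * cross w (y2 - z2) < 0].

(** The mixed triangle x y1 z2 is counterclockwise because x, being radially
    extreme, is not inside it; if it were largest, then the bases could be joined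
    through y1 z2, one end point at a time. *)
Lemma opposite_bases_lt y1 z1 y2 z2 : opposite_bases y1 z1 y2 z2 ->
  0 <= area2 x y1 z2 < M.
Proof.
move=> [b1 b2 opp]; have [Ky1 Kz1 e1] := b1; have [Ky2 Kz2 e2] := b2.
have T1 := baseP b1; have T2 := baseP b2.
apply/andP; split.
  have o1 := largest_triangle_origin hK (largest_triangle_rot (largest_triangle_rot T1)).
  have o2 := largest_triangle_origin hK (largest_triangle_rot T2).
  have := cross_subadd hK Kz2 (largest_triangle_extreme hK T1) Ky1 o2 o1.
  by rewrite area2E (crossC z2 y1); lra.
rewrite lt_neqAle base_le // andbT; apply/eqP => e.
have b : base y1 z2 by split.
have := base_side_z b1 b; have := base_side_y b b2.
by nra.
Qed.

(** Let the pair of bases maximize the sum of the two mixed areas, that is, be as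
    close together as possible. On the ray from x in the direction z1 - z2 take
    the last point q of K. It is between y1 and y2, and x q z1 and x q z2 have
    the same area. As K is inextensible, q is a vertex of a largest triangle
    x' q z', and an exchange with one of the given triangles, according to the
    side of x on which x' lies, shows that z1, z2 or z' forms a base with q. If
    it is z1 or z2, then it is both, and these bases join the given ones. If it
    is z', then this base with one of the two given ones is a pair of opposite
    bases with a larger sum. *)
Lemma optimal_opposite_bases_false y1 z1 y2 z2 : opposite_bases y1 z1 y2 z2 ->
  (forall a b c d, opposite_bases a b c d ->
    area2 x a d + area2 x c b <= area2 x y1 z2 + area2 x y2 z1) ->
  0 < cross (z1 - x) (z2 - x) -> False.
Proof.
move=> opp opt k0; have [b1 b2 neg] := opp.
have opp' : opposite_bases y2 z2 y1 z1 by split => //; rewrite mulrC.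
have /andP[g0 gM] := opposite_bases_lt opp; have /andP[e0 eM] := opposite_bases_lt opp'.
set g := area2 x y1 z2 in opt g0 gM; set e := area2 x y2 z1 in opt e0 eM.
set k := cross _ _ in k0.
have [Ky1 Kz1 e1] := b1; have [Ky2 Kz2 e2] := b2.
have T1 := baseP b1; have T2 := baseP b2.
pose D := z1 - z2.
pose A : set 'rV[R]_2 := K `&` [set v | cross (v - x) D = 0].
have crossX_cont v : continuous (fun p : 'rV[R]_2 => cross (p - x) v).
  move=> t; apply: (@continuous_cross _ _ (fun p : 'rV[R]_2 => p - x) (fun=> v)) => ?.
    apply: (@continuousB _ _ _ (fun p : 'rV[R]_2 => p) (fun=> x)); [exact: cvg_id|exact: cst_continuous]. 
  exact: cst_continuous.
have cA : compact A.
  have [_ cK _ _] := hK; apply: compact_closedI => //.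
  apply: (@closed_comp _ _ (fun v => cross (v - x) D) [set 0]); last exact: closed_eq.
  by move=> ? _; exact: crossX_cont.
(* The segment y1 y2 meets the ray at parameter t. *)
pose t := (M - e) / (2 * M - e - g).
have den0 : 0 < 2 * M - e - g by lra.
have t0 : 0 < t by rewrite divr_gt0 // subr_gt0.
have t1 : t <= 1 by rewrite ler_pdivrMr // mul1r; lra.
pose q0 := t *: y1 + (1 - t) *: y2.
pose v := t * M + (1 - t) * e.
have q0z1 : cross (q0 - x) (z1 - x) = v.
  by rewrite /v -e1 /e /q0; cross_ring.
have q0z2 : cross (q0 - x) (z2 - x) = v.
  transitivity (t * g + (1 - t) * M); first by rewrite -e2 /g /q0; cross_ring.
  by rewrite /v /t; field; rewrite gt_eqF.
have v0 : 0 < v.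
  have te : 0 <= (1 - t) * e by apply: mulr_ge0; first by rewrite subr_ge0.
  by have := mulr_gt0 t0 M_gt0; rewrite /v; lra.
have Aq0 : A q0.
  split; first by apply: domain_segment => //; rewrite (ltW t0).
  rewrite /= (_ : D = (z1 - x) - (z2 - x)); last by rewrite /D; vec_ring.
  by rewrite crossBr q0z1 q0z2 subrr.
have [|q [Kq qD] qmax] := compact_max (ex_intro _ q0 Aq0) cA (f := fun p => cross (p - x) (z1 - x)).
  exact: crossX_cont.
set l := cross (q - x) (z1 - x) in qmax.
have vl : v <= l by rewrite -q0z1; exact: qmax.
have l0 : 0 < l by lra.
have qz2 : cross (q - x) (z2 - x) = l.
  by apply/eqP; rewrite -subr_eq0 /l -crossBr -oppr_eq0 -crossNr; apply/eqP;
    rewrite -[RHS]qD /D; congr cross; vec_ring.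
have lM : l <= M by have := base_le Kq Kz1.
have qE : k *: (q - x) = l *: D.
  have := cross_combination (q - x) (z1 - x) (z2 - x).
  rewrite -/k -/l qz2 => comb; rewrite [k *: _](canRL (addrK _) comb).
  by rewrite -scalerBr /D; congr (_ *: _); vec_ring.
have q0E : v *: (q - x) = l *: (q0 - x).
  have k_neq0 : k != 0 by rewrite gt_eqF.
  have q0E' : k *: (q0 - x) = v *: D.
    have := cross_combination (q0 - x) (z1 - x) (z2 - x).
    rewrite -/k q0z1 q0z2 => comb; rewrite [k *: _](canRL (addrK _) comb).
    by rewrite -scalerBr /D; congr (_ *: _); vec_ring.
  apply: (scalerI k_neq0).
  by rewrite !scalerA [k * v]mulrC [k * l]mulrC -!scalerA qE q0E' !scalerA mulrC.
have [z' [x' [Kz' Kx' eT' _]]] : exists b c, [/\ K b, K c, area2 q b c = M & 0 <= cross D (b - c)].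
  apply: (inextensible_apex_limit hK hT inextK (u := 0)) => // d d0.
  rewrite scaler0 addr0 => Kd.
  have : A (q + d *: D).
    by split => //=; rewrite addrAC crossDl qD crossZl crossvv mulr0 addr0.
  move=> /qmax; rewrite addrAC crossDl crossZl -/l.
  rewrite (_ : cross D (z1 - x) = k); last by rewrite /D /k; cross_ring.
  by have := mulr_gt0 d0 k0; lra.
have T' : largest_triangle K x' q z'.
  split => // a b c *; rewrite -(area2_rot x') eT'.
  by case: hT => _ _ _; apply.
have T1' := largest_triangle_rot T'; have T2' := largest_triangle_rot T1'.
have par := radially_extreme_parallel hK.
have ext := largest_triangle_extreme hK.
have ex := ext _ _ _ T1; have eq := ext _ _ _ T1'; have ex' := ext _ _ _ T'.
have ey1 := ext _ _ _ (largest_triangle_rot T1).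
have ey2 := ext _ _ _ (largest_triangle_rot T2).
have xy1 := largest_triangle_origin hK (largest_triangle_rot (largest_triangle_rot T1)).
have xy2 := largest_triangle_origin hK (largest_triangle_rot (largest_triangle_rot T2)).
have xq : 0 <= cross x q.
  rewrite -(pmulr_rge0 _ v0).
  have -> : v * cross x q = l * (t * cross x y1 + (1 - t) * cross x y2).
    have -> : cross x q = cross x (q - x) by cross_ring.
    rewrite -crossZr q0E crossZr /q0; cross_ring.
  apply: mulr_ge0; first exact: ltW.
  by apply: addr_ge0; [apply: mulr_ge0 => //; exact: ltW|apply: mulr_ge0 => //; rewrite subr_ge0].
(* With the radial order of y1, q, y2 known, the exchanges can be oriented. *)
have y1q : 0 < cross y1 q.
  rewrite crossC oppr_gt0 ltNge; apply/negP => qy1.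
  have := cross_subadd hK Kx eq Ky1 xq qy1.
  have : k * area2 x q y1 < 0.
    have -> : k * area2 x q y1 = l * (g - M).
      by rewrite /area2 -crossZl qE crossZl -e1 /g /D; cross_ring.
    by rewrite pmulr_rlt0 // subr_lt0.
  by rewrite pmulr_rlt0 // area2E (crossC y1 x); lra.
have qy2 : 0 < cross q y2.
  rewrite crossC oppr_gt0 ltNge; apply/negP => y2q.
  have := cross_subadd hK Kx ey2 Kq xy2 y2q.
  have : k * area2 x y2 q < 0.
    have -> : k * area2 x y2 q = l * (e - M).
      by rewrite /area2 -crossZr qE crossZr -e2 /e /D; cross_ring.
    by rewrite pmulr_rlt0 // subr_lt0.
  by rewrite pmulr_rlt0 // area2E (crossC q x); lra.
have xq0 : 0 < cross x q.
  rewrite lt_neqAle xq andbT; apply/eqP => /esym /(par _ _ ex eq)[xqE|xqE].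
    by move: l0; rewrite /l -xqE subrr /cross !mxE !mul0r subrr ltxx.
  by move: xy2 qy2; rewrite xqE crossNl; lra.
have x'q := largest_triangle_origin hK T2'.
have base_q z : K z -> area2 x q z = M -> base q z by [].
have l_lt : l < M.
  rewrite lt_neqAle lM andbT; apply/eqP => lE.
  have bq1 := base_q _ Kz1 lE.
  have bq2 : base q z2 by apply: base_q; rewrite // /area2 qz2.
  have s1 := base_side_y b1 bq1; have s2 := base_side_z bq1 bq2.
  by have s3 := base_side_y bq2 b2; nra.
have bq : base q z'.
  apply: base_q => //; have [xx'|/ltW x'x] := lerP 0 (cross x x').
    have x'q0 : 0 < cross x' q.
      rewrite lt_neqAle x'q andbT; apply/eqP => /esym /(par _ _ ex' eq)[E|E].
        by have [] := largest_triangle_neq hK T'.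
      by move: xx'; rewrite E crossNr; lra.
    have x'y2 : 0 <= cross x' y2.
      rewrite -(pmulr_rge0 _ xq0) -cross_pluecker.
      by rewrite addr_ge0 // mulr_ge0 // ltW.
    have := exchange hK T2 T' xx' x'q0 (ltW qy2) xq x'y2; rewrite e2.
    case=> -[h _]; last exact: h.
    by move: l_lt; rewrite -qz2 [cross _ _]h ltxx.
  have {}x'x : 0 <= cross x' x by rewrite crossC; lra.
  have xy10 : 0 < cross x y1.
    rewrite lt_neqAle xy1 andbT; apply/eqP => /esym /(par _ _ ex ey1)[E|E].
      by have [] := largest_triangle_neq hK T1.
    by move: xq0; rewrite E crossNl; lra.
  have x'y1 : 0 <= cross x' y1.
    rewrite -(pmulr_lge0 _ xq0) -cross_pluecker.
    by rewrite addr_ge0 // mulr_ge0 // ltW.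
  have := exchange hK T' T1 x'x xy10 (ltW y1q) x'y1 xq.
  rewrite -(area2_rot x' q z') eT'.
  case=> -[_ h]; last exact: h.
  by move: l_lt; rewrite /l [cross _ _]h ltxx.
(* z' is seen from x between z1 and z2, beyond the line that joins them. *)
pose s1 := cross (z' - x) (z2 - x) / k; pose s2 := cross (z1 - x) (z' - x) / k.
have k_neq0 : k != 0 by rewrite gt_eqF.
have z'E : z' - x = s1 *: (z1 - x) + s2 *: (z2 - x).
  apply: (scalerI k_neq0); rewrite [RHS]scalerDr !scalerA /s1 /s2 ![k * _]mulrC !divfK //.
  have := cross_combination (z' - x) (z1 - x) (z2 - x).
  rewrite -/k => comb; rewrite [k *: _](canRL (addrK _) comb).
  by rewrite -scaleNr -crossC.
have lin y : area2 x y z' = s1 * area2 x y z1 + s2 * area2 x y z2.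
  by rewrite {1}/area2 z'E crossDr !crossZr.
have sumM : l * (s1 + s2) = M.
  have [_ _ <-] := bq; rewrite lin.
  by rewrite -[area2 x q z2]/(cross _ _) qz2 -[area2 x q z1]/l; ring.
have le1 := base_le Ky1 Kz'; have le2 := base_le Ky2 Kz'.
rewrite lin e1 -/g in le1; rewrite lin e2 -/e in le2.
have lM' : 0 < l <= M by rewrite l0.
have gM' : 0 <= g < M by rewrite g0.
have eM' : 0 <= e < M by rewrite e0.
have [side|side] := ltP (cross w (q - z') * cross w (y2 - z2)) 0.
  have := opt _ _ _ _ (And3 bq b2 side).
  rewrite lin e2 -/e -[area2 x q z2]/(cross _ _) qz2.
  have := crossing_gain eM' gM' lM' sumM le1; lra.
have side' : cross w (y1 - z1) * cross w (q - z') < 0.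
  exact: opposite_sign neg side (no_parallel_base bq).
have := opt _ _ _ _ (And3 b1 bq side').
rewrite lin e1 -/g -[area2 x q z1]/l.
have := @crossing_gain R M g e l s2 s1 gM' eM' lM'; rewrite addrC => /(_ _ _); lra.
Qed.

End ParallelBase.

Section ParallelBaseExists.
Context {R : realType}.
Variables (K : set 'rV[R]_2) (hK : symmetric_convex_domain K).
Implicit Types (a b c p q r u v w x y z : 'rV[R]_2).
Variables (tx ty tz : 'rV[R]_2) (hT : largest_triangle K tx ty tz).
Hypothesis inextK : inextensible K.
Let M := area2 tx ty tz.

(** Otherwise compactness gives a pair of opposite bases that is closest together
    in the sense of [optimal_opposite_bases_false]. *)
Lemma parallel_base_between x w y1 z1 y2 z2 : K x ->
  K y1 -> K z1 -> area2 x y1 z1 = M -> 0 <= cross w (y1 - z1) ->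
  K y2 -> K z2 -> area2 x y2 z2 = M -> cross w (y2 - z2) <= 0 ->
  exists y z, [/\ K y, K z, area2 x y z = M & cross w (y - z) = 0].
Proof.
move=> Kx Ky1 Kz1 e1 s1 Ky2 Kz2 e2 s2; apply: contrapT => no.
have M0 : 0 < M := largest_triangle_gt0 hK hT.
pose bs := base K tx ty tz x.
have nopar y z : bs y z -> cross w (y - z) != 0.
  by move=> [Ky Kz e]; apply/eqP => e0; apply: no; exists y, z.
pose V := (('rV[R]_2 * 'rV[R]_2) * ('rV[R]_2 * 'rV[R]_2))%type.
pose f1 (t : V) := area2 x t.1.1 t.1.2; pose f2 (t : V) := area2 x t.2.1 t.2.2.
pose g1 (t : V) := cross w (t.1.1 - t.1.2); pose g2 (t : V) := cross w (t.2.1 - t.2.2).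
have c11 : continuous (fun t : V => t.1.1).
  by move=> t; apply: continuous_comp; [exact: cvg_fst|exact: cvg_fst].
have c12 : continuous (fun t : V => t.1.2).
  by move=> t; apply: continuous_comp; [exact: cvg_fst|exact: cvg_snd].
have c21 : continuous (fun t : V => t.2.1).
  by move=> t; apply: continuous_comp; [exact: cvg_snd|exact: cvg_fst].
have c22 : continuous (fun t : V => t.2.2).
  by move=> t; apply: continuous_comp; [exact: cvg_snd|exact: cvg_snd].
have cx : continuous (fun _ : V => x) by exact: cst_continuous.
have cw : continuous (fun _ : V => w) by exact: cst_continuous.
have cf1 : continuous f1 := continuous_area2 cx c11 c12.
have cf2 : continuous f2 := continuous_area2 cx c21 c22.
pose f3 (t : V) := area2 x t.1.1 t.2.2; pose f4 (t : V) := area2 x t.2.1 t.1.2.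
have cf3 : continuous f3 := continuous_area2 cx c11 c22.
have cf4 : continuous f4 := continuous_area2 cx c21 c12.
have cg1 : continuous g1.
  apply: continuous_cross => // t.
  by apply: (@continuousB _ _ _ (fun t : V => t.1.1) (fun t : V => t.1.2)); [exact: c11|exact: c12].
have cg2 : continuous g2.
  apply: continuous_cross => // t.
  by apply: (@continuousB _ _ _ (fun t : V => t.2.1) (fun t : V => t.2.2)); [exact: c21|exact: c22].
pose A := ((K `*` K) `*` (K `*` K)) `&` (f1 @^-1` [set M] `&` f2 @^-1` [set M]
   `&` g1 @^-1` [set r : R | 0 <= r] `&` g2 @^-1` [set r : R | r <= 0]).
have cA : compact A.
  have [_ cK _ _] := hK; apply: compact_closedI; first by do !apply: compact_setX.
  have cl (f : V -> R) (D : set R) : continuous f -> closed D -> closed (f @^-1` D).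
    by move=> cf cD; apply: closed_comp => // ? _; exact: cf.
  apply: closedI; [apply: closedI; [apply: closedI|]|]; apply: cl => //.
have A0 : A !=set0 by exists ((y1, z1), (y2, z2)).
have [|[[a b] [c d]] Aabcd opt] := compact_max A0 cA (f := fun t => f3 t + f4 t).
  by move=> t; apply: (@continuousD _ _ _ f3 f4); [exact: cf3|exact: cf4].
move: Aabcd => [[[/= Ka Kb] [/= Kc Kd]]] [[[/= eab ecd] sab] scd].
rewrite /f1 /= in eab; rewrite /f2 /= in ecd; rewrite /g1 /= in sab; rewrite /g2 /= in scd.
have bab : bs a b by split.
have bcd : bs c d by split.
have opp : opposite_bases K tx ty tz x w a b c d.
  split => //; rewrite pmulr_rlt0 ?lt_neqAle ?scd ?nopar //.
  by rewrite sab eq_sym nopar.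
have opt' a' b' c' d' : opposite_bases K tx ty tz x w a' b' c' d' ->
    area2 x a' d' + area2 x c' b' <= area2 x a d + area2 x c b.
  move=> [[Ka' Kb' e] [Kc' Kd' e'] neg].
  have [s|/ltW s] := leP 0 (cross w (a' - b')).
    have s' : cross w (c' - d') <= 0.
      rewrite leNgt; apply/negP => s'; move: neg; rewrite ltNge => /negP; apply.
      by rewrite mulr_ge0 // ltW.
    by apply: (opt ((a', b'), (c', d'))); do !split.
  have s' : 0 <= cross w (c' - d').
    rewrite leNgt; apply/negP => s'; move: neg; rewrite ltNge => /negP; apply.
    by rewrite mulr_le0 // ltW.
  by rewrite addrC; apply: (opt ((c', d'), (a', b'))); do !split.
have false := optimal_opposite_bases_false hK hT inextK Kx nopar.
have opp' : opposite_bases K tx ty tz x w c d a b.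
  by case: opp => *; split => //; rewrite mulrC.
have [k0|k0|k0] := ltgtP 0 (cross (b - x) (d - x)).
- exact: false opp opt' k0.
- apply: (false _ _ _ _ opp'); last by rewrite crossC oppr_gt0.
  by move=> *; rewrite [leRHS]addrC; exact: opt'.
- have /andP[g0 gM] := opposite_bases_lt hK hT Kx nopar opp.
  have /andP[h0 hM] := opposite_bases_lt hK hT Kx nopar opp'.
  have : area2 x a b * area2 x c d - area2 x a d * area2 x c b
      = cross (a - x) (c - x) * cross (b - x) (d - x) by rewrite /area2 /cross; ring.
  rewrite -k0 mulr0 eab ecd => /eqP; rewrite subr_eq0 => /eqP e.
  have : area2 x a d * area2 x c b < M * M by exact: ltr_pM.
  by rewrite -e ltxx.
Qed.

End ParallelBaseExists.

(** * Support lines *)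

Section Support.
Context {R : realType}.
Implicit Types (K : set 'rV[R]_2) (a b c p q r u v w x y z : 'rV[R]_2) (theta : R).

(** [dir theta] turned by a right angle, the direction of the support line. *)
Definition normal_perp theta : 'rV[R]_2 := vec (- sin theta) (cos theta).

Lemma dotp_dir v theta : dotp v (dir theta) = cross v (normal_perp theta).
Proof.
rewrite /dotp !mxE !big_ord_recl big_ord0 addr0 /cross !mxE /=.
have -> : lift 0 0 = 1 :> 'I_2 by exact/val_inj.
have -> : ord0 = 0 :> 'I_2 by exact/val_inj.
by ring.
Qed.

Lemma polar v : v != 0 -> exists theta (l : R), 0 < l /\ v = l *: dir theta.
Proof.
move=> v0; pose s := v 0 0; pose t := v 0 1.
have n0 : 0 < s ^+ 2 + t ^+ 2.
  rewrite lt_neqAle addr_ge0 ?sqr_ge0 // andbT eq_sym paddr_eq0 ?sqr_ge0 //.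
  apply: contraNN v0; rewrite !sqrf_eq0 => /andP[/eqP s0 /eqP t0].
  by apply/eqP/vecP; rewrite !mxE.
pose l := Num.sqrt (s ^+ 2 + t ^+ 2).
have l0 : 0 < l by rewrite sqrtr_gt0.
have ln0 : l != 0 by rewrite gt_eqF.
have lE : l ^+ 2 = s ^+ 2 + t ^+ 2 by rewrite sqr_sqrtr // ltW.
have unit : (s / l) ^+ 2 + (t / l) ^+ 2 = 1.
  by rewrite !expr_div_n -mulrDl -lE divff // expf_neq0.
have range : -1 <= s / l <= 1.
  rewrite -ler_norml -(@ler_pXn2r _ 2) ?nnegrE // ?normr_ge0 ?ler01 // real_normK ?num_real //.
  by have := sqr_ge0 (t / l); lra.
pose th := acos (s / l).
have cth : cos th = s / l by rewrite acosK // in_itv.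
have sth : sin th = `|t / l|.
  rewrite sin_acos // -sqrtr_sqr; congr Num.sqrt; lra.
have [t0|/ltW t0] := leP 0 (t / l).
  exists th, l; split => //; apply: vecP; rewrite !mxE /= ?cth ?sth ?(ger0_norm t0);
    by rewrite mulrC divfK.
exists (- th), l; split => //; apply: vecP; rewrite !mxE /= ?cosN ?sinN ?cth ?sth.
  by rewrite mulrC divfK.
by rewrite (ler0_norm t0) opprK mulrC divfK.
Qed.

Lemma dotp_continuous u : continuous (fun v => dotp v u).
Proof.
have E : (fun v => dotp v u) = (fun v => cross v (vec (- u 0 1) (u 0 0))).
  apply/funext => v; rewrite /dotp !mxE !big_ord_recl big_ord0 addr0 /cross !mxE /=.
  have -> : lift 0 0 = 1 :> 'I_2 by exact/val_inj.
  have -> : ord0 = 0 :> 'I_2 by exact/val_inj.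
  by ring.
by rewrite E; apply: continuous_cross => ?; [exact: cvg_id|exact: cst_continuous].
Qed.

Lemma support_lineP K theta x : K x ->
  (forall y, K y -> dotp y (dir theta) <= dotp x (dir theta)) -> support_line K theta x.
Proof.
move=> Kx xmax; rewrite /support_line /=; apply: le_anti; apply/andP; split.
  apply: ub_le_sup; last by exists x.
  by exists (dotp x (dir theta)) => _ [y Ky <-]; exact: xmax.
apply: ge_sup; first by exists (dotp x (dir theta)); exists x.
by move=> _ [y Ky <-]; exact: xmax.
Qed.

Lemma support_exists K theta : symmetric_convex_domain K ->
  exists x, [/\ K x, support_line K theta x &
    forall y, K y -> dotp y (dir theta) <= dotp x (dir theta)].
Proof.
move=> hK; have [_ cK _ _] := hK.
have [x Kx xmax] := @compact_max R 'rV[R]_2 K _ (ex_intro _ 0 (domain0 hK)) cK (@dotp_continuous (dir theta)).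
by exists x; split => //; exact: support_lineP.
Qed.

(** The normal is the direction from the point k of K nearest to p to p. *)
Lemma separation K p : symmetric_convex_domain K -> ~ K p ->
  exists theta, forall y, K y -> dotp y (dir theta) < dotp p (dir theta).
Proof.
move=> hK nKp; have [_ cK _ _] := hK.
pose dist (v : 'rV[R]_2) := - ((v 0 0 - p 0 0) ^+ 2 + (v 0 1 - p 0 1) ^+ 2).
have cdist : continuous dist.
  have E : dist = (fun v => cross (v - p) (vec (v 0 1 - p 0 1) (- (v 0 0 - p 0 0)))).
    by apply/funext => v; rewrite /dist /cross !mxE /=; ring.
  move=> v; have cc j : {for v, continuous (fun v : 'rV[R]_2 => v 0 j - p 0 j)}.
    apply: (@continuousB R R^o _ (fun v : 'rV[R]_2 => v 0 j) (fun=> p 0 j)); last exact: cst_continuous.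
    exact: coord_continuous.
  apply: (@continuousN R R^o _ (fun v : 'rV[R]_2 => (v 0 0 - p 0 0) ^+ 2 + (v 0 1 - p 0 1) ^+ 2)).
  apply: (@continuousD R R^o _ (fun v : 'rV[R]_2 => (v 0 0 - p 0 0) ^+ 2) (fun v : 'rV[R]_2 => (v 0 1 - p 0 1) ^+ 2)).
    by apply: (@continuousM R _ (fun v : 'rV[R]_2 => v 0 0 - p 0 0) (fun v : 'rV[R]_2 => v 0 0 - p 0 0)); exact: cc.
  by apply: (@continuousM R _ (fun v : 'rV[R]_2 => v 0 1 - p 0 1) (fun v : 'rV[R]_2 => v 0 1 - p 0 1)); exact: cc.
have [k Kk kmin] := @compact_max R 'rV[R]_2 K _ (ex_intro _ 0 (domain0 hK)) cK cdist.
have pk0 : p - k != 0 by rewrite subr_eq0; apply/eqP => e; apply: nKp; rewrite e.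
have [theta [l [l0 pkE]]] := polar pk0.
exists theta => y Ky; rewrite -subr_gt0.
have -> : dotp p (dir theta) - dotp y (dir theta)
   = ((p - y) 0 0 * (p - k) 0 0 + (p - y) 0 1 * (p - k) 0 1) / l.
  by rewrite !dotp_dir pkE /cross !mxE /=; field; rewrite gt_eqF.
rewrite divr_gt0 //.
pose al := p 0 0 - k 0 0; pose be := p 0 1 - k 0 1.
pose ga := y 0 0 - k 0 0; pose de := y 0 1 - k 0 1.
have n0 : 0 < al ^+ 2 + be ^+ 2.
  rewrite lt_neqAle addr_ge0 ?sqr_ge0 // andbT eq_sym paddr_eq0 ?sqr_ge0 //.
  apply: contraNN pk0; rewrite !sqrf_eq0 => /andP[/eqP s0 /eqP t0].
  by apply/eqP/vecP; rewrite !mxE.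
(* Moving from k towards y does not decrease the distance to p. *)
have key (t : R) : 0 <= t <= 1 -> 2 * t * (al * ga + be * de) <= t ^+ 2 * (ga ^+ 2 + de ^+ 2).
  move=> t01; have := kmin _ (domain_segment hK t01 Ky Kk).
  rewrite /dist lerN2 !mxE -subr_ge0 => h; rewrite -subr_ge0; apply: le_trans h _.
  by rewrite le_eqVlt; apply/orP; left; apply/eqP; rewrite /al /be /ga /de; ring.
have ip : al * ga + be * de <= 0.
  rewrite leNgt; apply/negP => ip.
  pose S := ga ^+ 2 + de ^+ 2.
  have S0 : 0 <= S by rewrite addr_ge0 ?sqr_ge0.
  pose t := Num.min 1 ((al * ga + be * de) / (S + 1)).
  have t0 : 0 < t by rewrite lt_min ltr01 divr_gt0 //; lra.
  have t1 : t <= 1 by rewrite ge_min lexx.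
  have t2 : t * (S + 1) <= al * ga + be * de.
    by rewrite -ler_pdivlMr ?ge_min ?lexx ?orbT //; lra.
  have := key t; rewrite (ltW t0) t1 => /(_ isT).
  rewrite -mulrA expr2 -mulrA mulrCA ler_pM2l // -/S; lra.
rewrite !mxE -/al -/be.
have -> : p 0 0 - y 0 0 = al - ga by rewrite /al /ga; ring.
have -> : p 0 1 - y 0 1 = be - de by rewrite /be /de; ring.
by lra.
Qed.

End Support.

(** * The maximal area in a given direction *)

Section MaxTriangleArea.
Context {R : realType}.
Variables (K : set 'rV[R]_2) (hK : symmetric_convex_domain K).
Implicit Types (a b c p q r u v w x y z : 'rV[R]_2) (theta : R).
Variables (tx ty tz : 'rV[R]_2) (hT : largest_triangle K tx ty tz).
Let M := area2 tx ty tz.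

Lemma boundary_sub p : boundary K p -> K p.
Proof. by move=> [+ _]; rewrite -(closure_id _).1 //; exact: domain_closed. Qed.

Lemma radially_extreme_boundary p : radially_extreme K p -> boundary K p.
Proof.
move=> [Kp out]; split; first exact: subset_closure.
move=> /nbhs_ballP [r /= r0 rK].
have p1 : 0 < `|p| + 1 by rewrite ltr_wpDl.
pose t := r / (2 * (`|p| + 1)); have t0 : 0 < t by rewrite divr_gt0 // mulr_gt0.
apply: (out (1 + t)); first by lra.
apply: rK; rewrite -ball_normE /= scalerDl scale1r opprD addNKr normrN normrZ gtr0_norm //.
have tE : t * (2 * (`|p| + 1)) = r by rewrite divfK // gt_eqF // mulr_gt0.
have := mulr_ge0 (ltW t0) (normr_ge0 p); lra.
Qed.

Lemma max_triangle_area_ub theta :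
  ubound [set a | exists x y z : 'rV[R]_2,
    [/\ inscribed_triangle K x y z, support_line K theta x,
        dotp (z - y) (dir theta) = 0 & a = triangle_area x y z]] (M / 2).
Proof.
move=> _ [x [y [z [[_ /boundary_sub Kx /boundary_sub Ky /boundary_sub Kz] _ _ ->]]]].
by rewrite triangle_areaE ler_pM2r //; exact: (largest_triangle_norm hT Kx Ky Kz).
Qed.

Lemma max_triangle_area_attained theta x y z : largest_triangle K x y z ->
  cross (normal_perp theta) (y - z) = 0 -> support_line K theta x ->
  max_triangle_area K theta = M / 2.
Proof.
move=> T par Lx; have M0 := largest_triangle_gt0 hK T.
have eM : area2 x y z = M := largest_triangle_uniq hT T.
have bd p q r : largest_triangle K p q r -> boundary K p.
  by move=> /(largest_triangle_extreme hK); exact: radially_extreme_boundary.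
have aE : triangle_area x y z = M / 2 by rewrite triangle_areaE gtr0_norm // eM.
apply: le_anti; apply/andP; split; last first.
  apply: ub_le_sup; first by exists (M / 2); exact: max_triangle_area_ub.
  exists x, y, z; split => //.
    split; first by rewrite aE divr_gt0 // -eM.
    - exact: bd T.
    - exact: bd (largest_triangle_rot T).
    - exact: bd (largest_triangle_rot (largest_triangle_rot T)).
  by rewrite dotp_dir crossC -crossNr opprB.
apply: ge_sup; last exact: max_triangle_area_ub.
exists (M / 2), x, y, z; split => //.
  split; first by rewrite aE divr_gt0 // -eM.
  - exact: bd T.
  - exact: bd (largest_triangle_rot T).
  - exact: bd (largest_triangle_rot (largest_triangle_rot T)).
by rewrite dotp_dir crossC -crossNr opprB.
Qed.

(** A point x of the support line is approached from outside K along the line in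
    both directions, which gives bases on both sides of its direction, and
    [parallel_base_between] gives one that is parallel to it. *)
Lemma inextensible_max_triangle_area theta : inextensible K ->
  max_triangle_area K theta = M / 2.
Proof.
move=> inextK; have [x [Kx Lx xmax]] := support_exists theta hK.
set w := normal_perp theta.
(* The points x + e *: (s *: w) may be in K; the normal term moves them out. *)
have out s (e : R) : 0 < e -> ~ K (x + e *: (s *: w + e *: dir theta)).
  move=> e0 /xmax; rewrite !dotp_dir -/w.
  have -> : cross (x + e *: (s *: w + e *: dir theta)) w
      = cross x w + e ^+ 2 * (cos theta ^+ 2 + sin theta ^+ 2).
    by rewrite /w /cross !mxE /=; ring.
  by rewrite cos2Dsin2 mulr1; have := exprn_gt0 2 e0; lra.
have [y1 [z1 [Ky1 Kz1 e1]]] := inextensible_apex_limit hK hT inextK Kx (@out 1).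
rewrite scale1r => s1.
have [y2 [z2 [Ky2 Kz2 e2]]] := inextensible_apex_limit hK hT inextK Kx (@out (-1)).
rewrite scaleN1r crossNl oppr_ge0 => s2.
have [y [z [Ky Kz e par]]] :=
  parallel_base_between hK hT inextK Kx Ky1 Kz1 e1 s1 Ky2 Kz2 e2 s2.
apply: (@max_triangle_area_attained theta x y z) => //.
by split => // a b c *; rewrite e; case: hT => _ _ _; apply.
Qed.

(** The apex of a largest triangle is on the support line parallel to the base. *)
Lemma max_triangle_area_some : exists theta, max_triangle_area K theta = M / 2.
Proof.
have [ktx kty ktz max] := hT; have M0 := largest_triangle_gt0 hK hT.
have v0 : vec ((ty - tz) 0 1) (- (ty - tz) 0 0) != 0.
  apply/eqP => e; move: M0.
  have e0 : (ty - tz) 0 1 = 0 by have := congr1 (fun v : 'rV[R]_2 => v 0 0) e; rewrite !mxE.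
  have e1 : (ty - tz) 0 0 = 0.
    by have := congr1 (fun v : 'rV[R]_2 => v 0 1) e; rewrite !mxE /= => /eqP; rewrite oppr_eq0 => /eqP.
  have -> : area2 tx ty tz = cross (tx - ty) (ty - tz) by cross_ring.
  by rewrite /cross e0 e1 !mulr0 subr0 ltxx.
have [theta [l [l0 vE]]] := polar v0.
have bE : ty - tz = l *: normal_perp theta.
  have e0 : (ty - tz) 0 1 = l * cos theta.
    by have := congr1 (fun v : 'rV[R]_2 => v 0 0) vE; rewrite !mxE.
  have e1 : - (ty - tz) 0 0 = l * sin theta.
    by have := congr1 (fun v : 'rV[R]_2 => v 0 1) vE; rewrite !mxE.
  apply: vecP; last by rewrite e0 !mxE.
  by rewrite -[LHS]opprK e1 !mxE /= mulrN.
exists theta; apply: (max_triangle_area_attained hT).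
  by rewrite bE crossZr crossvv mulr0.
apply: support_lineP => // p Kp.
have := max _ _ _ Kp kty ktz; rewrite -subr_le0 area2_apex bE crossZr pmulr_rle0 //.
by rewrite crossBl subr_le0 !dotp_dir.
Qed.

(** A point p of an extension K' is beyond some support line of K. Moving the apex
    of a triangle that competes for this direction to p multiplies its area by a
    factor bounded away from 1, and the result is bounded by the largest area in
    K', which is that in K because the critical determinants agree. *)
Lemma max_triangle_area_inextensible :
  (forall theta, max_triangle_area K theta = M / 2) -> inextensible K.
Proof.
move=> AM [K' [hK' KK' K'K cd]].
have M0 : 0 < M := largest_triangle_gt0 hK hT.
have [x' [y' [z' T']]] := largest_triangle_exists hK'.
have eM : area2 x' y' z' = M.
  by rewrite -(critical_determinantE hK' T') cd (critical_determinantE hK hT).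
have [p K'p nKp] : exists2 p, K' p & ~ K p.
  apply: contrapT => no; apply: K'K; apply/seteqP; split => // p K'p.
  by apply: contrapT => nKp; apply: no; exists p.
have [theta sep] := separation hK nKp.
have [x0 [Kx0 Lx0 x0max]] := support_exists theta hK.
set u := dir theta in sep x0max; set h := dotp x0 u in x0max.
have dN v : dotp (- v) u = - dotp v u by rewrite /u !dotp_dir crossNl.
pose d := dotp p u - h; have d0 : 0 < d by rewrite subr_gt0; exact: sep.
have h_ge0 : 0 <= h by have := x0max _ (domain_opp hK Kx0); rewrite dN -/h; lra.
(* A height above the base is at most 2 * h, and moving to p adds d to it. *)
pose rho := d / (2 * h + d).
have rho0 : 0 < rho by rewrite divr_gt0 //; lra.
suff : max_triangle_area K theta <= M / 2 * (1 - rho).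
  by rewrite AM; have := mulr_gt0 M0 rho0; lra.
have rho1 : rho <= 1 by rewrite ler_pdivrMr ?mul1r; lra.
rewrite /max_triangle_area; set E := [set _ | _].
have [E0|E0] := pselect (E !=set0); last first.
  have -> : E = set0 by apply/seteqP; split=> // a Ea; apply: E0; exists a.
  by rewrite sup0 mulr_ge0 ?subr_ge0 // divr_ge0 // ltW.
apply: ge_sup => //.
move=> _ [x [y [z [[a0 /boundary_sub Kx /boundary_sub Ky /boundary_sub Kz] Lx par ->]]]].
have hx : dotp x u = h by rewrite /h; move: Lx Lx0; rewrite /support_line /= => -> ->.
have uE := dotp_dir.
have yz_u : dotp y u = dotp z u by apply/eqP; move/eqP: par; rewrite !uE crossBl subr_eq0 eq_sym.
rewrite triangle_areaE in a0 *.
have cs := cos2Dsin2 theta.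
pose mu := (y - z) 0 1 * cos theta - (y - z) 0 0 * sin theta.
have baseE : y - z = mu *: normal_perp theta.
  move: par; rewrite dotp_dir /cross !mxE /= => par.
  have cs_mul (r : R) : r * (cos theta ^+ 2 + sin theta ^+ 2) = r by rewrite cs mulr1.
  apply: vecP; rewrite !mxE /= /mu !mxE.
    have := congr1 ( *%R (cos theta)) par; have := cs_mul (y 0 0 - z 0 0); lra.
  have := congr1 ( *%R (sin theta)) par; have := cs_mul (y 0 1 - z 0 1); lra.
have aE v : area2 v y z = mu * (dotp v u - dotp y u).
  have -> : area2 v y z = cross (v - y) (y - z) by cross_ring.
  by rewrite baseE crossZr crossBl /u !dotp_dir.
have le_p : `|mu| * (h + d - dotp y u) <= M.
  have := largest_triangle_norm T' K'p (KK' _ Ky) (KK' _ Kz).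
  rewrite eM aE (_ : h + d = dotp p u); last by rewrite /d; ring.
  by rewrite normrM [X in _ * X]ger0_norm // subr_ge0 ltW // sep.
have ty_le : dotp y u <= h by exact: x0max.
have ty_ge : - h <= dotp y u by have := x0max _ (domain_opp hK Ky); rewrite dN -/h; lra.
have -> : `|area2 x y z| = `|mu| * (h - dotp y u).
  by rewrite aE hx normrM [X in _ * X]ger0_norm // subr_ge0.
rewrite [leRHS]mulrAC ler_pM2r //.
have hd : 0 < 2 * h + d by lra.
have -> : M * (1 - rho) = M * (2 * h) / (2 * h + d) by rewrite /rho; field; rewrite gt_eqF.
rewrite ler_pdivlMr // -mulrA.
have le1 : (h - dotp y u) * (2 * h + d) <= (h + d - dotp y u) * (2 * h).
  rewrite -subr_ge0 (_ : _ - _ = d * (h + dotp y u)); last by ring.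
  by rewrite mulr_ge0 // ?(ltW d0) //; lra.
have le2 : `|mu| * ((h - dotp y u) * (2 * h + d)) <= `|mu| * ((h + d - dotp y u) * (2 * h)).
  by rewrite ler_wpM2l.
apply: le_trans le2 _; rewrite [leLHS]mulrA; apply: ler_wpM2r => //; lra.
Qed.

End MaxTriangleArea.

Theorem theorem1 (R : realType) (K : set 'rV[R]_2)
    (hK : symmetric_convex_domain K) :
  inextensible K <->
  exists c : R, forall theta : R, max_triangle_area K theta = c.
Proof.
have [x [y [z T]]] := largest_triangle_exists hK; split=> [inextK|[c Ac]].
  by exists (area2 x y z / 2) => theta; exact: inextensible_max_triangle_area.
have [theta0 A0] := max_triangle_area_some hK T.
apply: (max_triangle_area_inextensible hK T) => theta.
by rewrite -A0 !Ac.
Qed.
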